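(* Let $N$ be a matroid on a non-empty finite set $E$, let $T$ be a skew tract, let $[\cdot]\colon A_N\to T$ be a map, and let $\mathcal{C}\subseteq T^E$. The following are equivalent. (1) $\mathcal{M}=(E,\mathcal{C})$ is a weak left (resp. right) $T$-matroid such that $\underline{\mathcal{M}}=N$ and $[\cdot]=[\cdot]_{\mathcal{C}}$. (2) $[\cdot]$ are weak left (resp. right) quasi-Plücker coordinates for $N$ and $\mathcal{C}=\mathcal{C}_{[\cdot]}$.
   Context: **Skew tracts.** A skew tract $T$ is a group $G$ (written multiplicatively, identity $1$) together with a subset $N_G$ of the group semiring $\mathbb{N}[G]$ such that: (1) $0\in N_G$; (2) $1\notin N_G$; (3) there is a unique $\epsilon\in G$ with $1+\epsilon\in N_G$; (4) $N_G$ is closed under the left and right actions of $G$ on $\mathbb{N}[G]$. Write $T=G\cup\{0\}$, $T^\times=G$, where $0$ is identified with the zero of $\mathbb{N}[G]$ and is absorbing for multiplication; $-x:=\epsilon x$ (one has $\epsilon x=x\epsilon$ and $\epsilon^2=1$). $T^E$ is the set of functions $E\to T$, with coordinatewise left and right multiplication by $T$. The support of $X\in T^E$ is $\underline{X}=\{e\in E: X(e)\neq 0\}$; for $S\subseteq T^E$, $\underline{S}$ is the set of supports of elements of $S$. **Modular pairs.** For a collection $C$ of pairwise incomparable non-empty subsets of $E$, $U(C)=\{\bigcup S: S\subseteq C\}$ is a lattice under inclusion (join is union). Two distinct members of $C$ form a modular pair if their union has height $2$ in $U(C)$. $X,Y\in\mathcal{C}\subseteq T^E$ form a modular pair if $\underline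 X,\underline Y$ form a modular pair in $\underline{\mathcal{C}}$. **Weak $T$-matroids.** $\mathcal{C}\subseteq T^E$ is the $T$-circuit set of a weak left $T$-matroid $\mathcal{M}=(E,\mathcal{C})$ on $E$ if: (C1) $0\notin\mathcal{C}$; (C2) $X\in\mathcal{C}$, $\alpha\in T^\times$ imply $\alpha X\in\mathcal{C}$; (C3) if $X,Y\in\mathcal{C}$ and $\underline X\subseteq\underline Y$ then $Y=\alpha X$ for some $\alpha\in T^\times$; (C4) if $X,Y\in\mathcal{C}$ form a modular pair and $e\in E$ satisfies $X(e)=-Y(e)\ne0$, there is $Z\in\mathcal{C}$ with $Z(e)=0$ and $X(f)+Y(f)-Z(f)\in N_G$ for all $f\in E$. Weak right $T$-matroids are defined by replacing $\alpha X$ with $X\alpha$ in (C2), (C3). The underlying matroid $\underline{\mathcal{M}}$ is the matroid on $E$ whose circuits are the supports of the elements of $\mathcal{C}$. **Adjacent bases.** Let $N$ have rank $r$ and set of bases $\mathcal{B}$. $A_N$ is the set of ordered pairs $(B,B')$ of bases with $|B\setminus B'|=1$. $Fa_1\dots a_n$ denotes $F\cup\{a_1,\dots,a_n\}$, with $a_1,\dots,a_n$ distinct elements of $E\setminus F$. **Weak left quasi-Plücker coordinates** for $N$: a map $[\cdot]\colon A_N\to T$ such that (P1) $[Fa,Fb][Fb,Fa]=1$ if $|F|=r-1$, $Fa,Fb\in\mathcal{B}$; (P2) $[Fac,Fbc][Fab,Fac][Fbc,Fab]=-1$ if $|F|=r-2$, $Fab,Fac,Fbc\in\mathcal{B}$;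 (P3) $[Fa,Fb][Fb,Fc][Fc,Fa]=1$ if $|F|=r-1$, $Fa,Fb,Fc\in\mathcal{B}$; (P4) $[Fac,Fbc]=[Fad,Fbd]$ if $|F|=r-2$, $Fac,Fad,Fbc,Fbd\in\mathcal{B}$ and ($Fab\notin\mathcal{B}$ or $Fcd\notin\mathcal{B}$); (P5) $-1+[Fbd,Fab][Fac,Fcd]+[Fad,Fab][Fbc,Fcd]\in N_G$ if $|F|=r-2$ and $Fac,Fad,Fbc,Fbd,Fab,Fcd\in\mathcal{B}$. Weak right quasi-Plücker coordinates are defined by the same axioms with the order of all products reversed. **$[\cdot]_{\mathcal C}$ and $\mathcal C_{[\cdot]}$ (left version).** If $\mathcal{C}$ satisfies (C1)–(C3) and $\underline{\mathcal{C}}$ is the set of circuits of $N$, then $[Fa,Fb]_{\mathcal{C}}:=-X(a)^{-1}X(b)$ for any $X\in\mathcal{C}$ with $a,b\in\underline X\subseteq Fab$ (well defined). For a map $[\cdot]\colon A_N\to T$, $\mathcal{C}_{[\cdot]}:=\{X\in T^E: \underline X$ is a circuit of $N$ and $X(a)^{-1}X(b)=-[Fa,Fb]$ whenever $a,b\in\underline X\subseteq Fab$ with $(Fa,Fb)\in A_N\}$. In the right version the order of multiplication is reversed, i.e. $X(a)^{-1}X(b)$ is replaced by $X(b)X(a)^{-1}$. *)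

(* Defs.v *)
From mathcomp Require Import all_boot.
From mathcomp Require Import boolp classical_sets.
From mathcomp Require Import finmap multiset.

Set Implicit Arguments.
Unset Strict Implicit.
Unset Printing Implicit Defensive.

Declare Scope tract_scope.
Delimit Scope tract_scope with T.

(* {mset G}, the finitely supported functions G -> nat, is the additive monoid
   underlying the group semiring N[G]; [mset g] is the basis element g, and
   seq_mset s is the formal sum of the entries of s. *)
Definition lact (G : groupType) (g : G) (x : {mset G}%mset) : {mset G}%mset :=
  seq_mset [seq (g * h)%g | h <- enum_mset x].

Definition ract (G : groupType) (g : G) (x : {mset G}%mset) : {mset G}%mset :=
  seq_mset [seq (h * g)%g | h <- enum_mset x].

Record skewTract := SkewTract {
  tract_group : groupType;
  null : set ({mset tract_group}%mset);
  tract_eps : tract_group;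
  null0 : null mset0;
  null1 : ~ null [mset 1%g]%mset;
  null_eps : null [mset 1%g; tract_eps]%mset;
  eps_unique : forall e : tract_group, null [mset 1%g; e]%mset -> e = tract_eps;
  null_lact : forall g x, null x -> null (lact g x);
  null_ract : forall g x, null x -> null (ract g x)
}.

(* T = G ∪ {0}, with None as 0 *)
Definition tract_sort (T : skewTract) := option (tract_group T).
Coercion tract_sort : skewTract >-> Sortclass.

(* The right versions of all notions are the left ones with the order of every
   product reversed. *)
Variant side := Left | Right.

Section TractOperations.
Variable T : skewTract.
Implicit Types x y : T.

Definition tzero : T := None.
Definition tone : T := Some 1%g.

Definition tmul x y : T :=
  if x is Some g then if y is Some h then Some (g * h)%g else None else None.

(* only meaningful for x <> 0 *)
Definition tinv x : T := omap (fun g => g^-1)%g x.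

Definition topp x : T := tmul (Some (tract_eps T)) x.

Definition smul (s : side) x y : T :=
  match s with Left => tmul x y | Right => tmul y x end.

Definition formal x : {mset tract_group T}%mset :=
  if x is Some g then [mset g]%mset else mset0.

Definition null_sum3 x y z : Prop :=
  null (formal x `+` formal y `+` formal z)%mset.

End TractOperations.

Arguments tzero {T}.
Arguments tone {T}.

Notation "0" := tzero : tract_scope.
Notation "1" := tone : tract_scope.
Notation "- x" := (topp x) : tract_scope.
Notation "- 1" := (topp tone) : tract_scope.
Notation "x ^-1" := (tinv x) : tract_scope.
Notation "x *_[ s ] y" := (smul s x y)
  (at level 40, left associativity, format "x  *_[ s ]  y") : tract_scope.

Section Vectors.
Variables (E : finType) (T : skewTract).

Definition supp (X : {ffun E -> T}) : {set E} := [set e | X e != 0%T]%SET.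

Definition scale (s : side) (x : T) (X : {ffun E -> T}) : {ffun E -> T} :=
  [ffun e => (x *_[s] X e)%T].

Definition supports (C : set {ffun E -> T}) : set {set E} :=
  [set supp X | X in C]%classic.

End Vectors.

Section ModularPairs.
Variable E : finType.
Implicit Types C U : set {set E}.

Definition union_lattice C : set {set E} :=
  [set A | exists2 S : {set {set E}},
     (forall B, B \in S -> C B) & A = finset.cover S]%classic.

(* s lists, in increasing order, the members other than set0 of a chain of U
   from the bottom element set0 to A; size s is the length of the chain. *)
Definition chain_to U (A : {set E}) (s : seq {set E}) : Prop :=
  [/\ forall B, B \in s -> U B,
      path (fun B B' : {set E} => B \proper B') finset.set0 s
    & last finset.set0 s = A].

Definition has_height U (A : {set E}) (n : nat) : Prop :=
  (exists2 s, chain_to U A s & size s = n) /\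
  (forall s, chain_to U A s -> size s <= n).

Definition modular_pair C (A B : {set E}) : Prop :=
  [/\ C A, C B, A <> B & has_height (union_lattice C) (A :|: B)%SET 2].

End ModularPairs.

Record matroid (E : finType) := Matroid {
  indep : {set {set E}};
  indep0 : finset.set0 \in indep;
  indep_sub : forall A B : {set E}, A \subset B -> B \in indep -> A \in indep;
  indep_aug : forall A B : {set E}, A \in indep -> B \in indep -> #|A| < #|B| ->
    exists2 e, e \in (B :\: A)%SET & (e |: A)%SET \in indep
}.

Section MatroidNotions.
Variables (E : finType) (N : matroid E).

Definition bases : {set {set E}} :=
  [set B | maxset (fun A => A \in indep N) B]%SET.

Definition circuits : {set {set E}} :=
  [set C | minset (fun A => A \notin indep N) C]%SET.

Definition rank : nat := \max_(A in indep N) #|A|.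

Definition adjacent (p : {set E} * {set E}) : bool :=
  [&& p.1 \in bases, p.2 \in bases & #|(p.1 :\: p.2)%SET| == 1].

Definition adj_bases := {p : {set E} * {set E} | adjacent p}.

End MatroidNotions.

(* F a_1 ... a_n, for s = [:: a_1; ...; a_n] *)
Definition ext (E : finType) (F : {set E}) (s : seq E) : {set E} :=
  (F :|: [set x in s])%SET.

Definition fresh (E : finType) (F : {set E}) (s : seq E) : bool :=
  uniq s && all (fun x => x \notin F) s.

Record weak_matroid (s : side) (E : finType) (T : skewTract)
    (C : set {ffun E -> T}) : Prop := WeakMatroid {
  circ_nonzero : ~ C [ffun=> 0%T];
  circ_scale : forall X (x : T), C X -> x <> 0%T -> C (scale s x X);
  circ_incomparable : forall X Y, C X -> C Y -> supp X \subset supp Y ->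
    exists2 x : T, x <> 0%T & Y = scale s x X;
  circ_modular_elim : forall X Y e, C X -> C Y ->
    modular_pair (supports C) (supp X) (supp Y) ->
    X e = (- Y e)%T -> X e <> 0%T ->
    exists Z, [/\ C Z, Z e = 0%T & forall f, null_sum3 (X f) (Y f) (- Z f)%T]
}.

Section QuasiPlucker.
Variables (s : side) (E : finType) (N : matroid E) (T : skewTract).

(* q is only defined on A_N; [q]_(B, B') is a junk 0 off A_N *)
Definition coord_at (q : adj_bases N -> T) (B B' : {set E}) : T :=
  oapp q 0%T (insub (B, B')).

Local Notation basis F s := (ext F s \in bases N) (only parsing).

Record weak_quasi_plucker (q : adj_bases N -> T) : Prop := WeakQuasiPlucker {
  qp1 : forall F a b, fresh F [:: a; b] -> #|F|.+1 = rank N ->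
    basis F [:: a] -> basis F [:: b] ->
    (coord_at q (ext F [:: a]) (ext F [:: b])
      *_[s] coord_at q (ext F [:: b]) (ext F [:: a]) = 1)%T;
  qp2 : forall F a b c, fresh F [:: a; b; c] -> #|F|.+2 = rank N ->
    basis F [:: a; b] -> basis F [:: a; c] -> basis F [:: b; c] ->
    (coord_at q (ext F [:: a; c]) (ext F [:: b; c])
      *_[s] coord_at q (ext F [:: a; b]) (ext F [:: a; c])
      *_[s] coord_at q (ext F [:: b; c]) (ext F [:: a; b]) = - 1)%T;
  qp3 : forall F a b c, fresh F [:: a; b; c] -> #|F|.+1 = rank N ->
    basis F [:: a] -> basis F [:: b] -> basis F [:: c] ->
    (coord_at q (ext F [:: a]) (ext F [:: b])
      *_[s] coord_at q (ext F [:: b]) (ext F [:: c])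
      *_[s] coord_at q (ext F [:: c]) (ext F [:: a]) = 1)%T;
  qp4 : forall F a b c d, fresh F [:: a; b; c; d] -> #|F|.+2 = rank N ->
    basis F [:: a; c] -> basis F [:: a; d] ->
    basis F [:: b; c] -> basis F [:: b; d] ->
    ~~ basis F [:: a; b] \/ ~~ basis F [:: c; d] ->
    coord_at q (ext F [:: a; c]) (ext F [:: b; c])
      = coord_at q (ext F [:: a; d]) (ext F [:: b; d]);
  qp5 : forall F a b c d, fresh F [:: a; b; c; d] -> #|F|.+2 = rank N ->
    basis F [:: a; c] -> basis F [:: a; d] ->
    basis F [:: b; c] -> basis F [:: b; d] ->
    basis F [:: a; b] -> basis F [:: c; d] ->
    null_sum3 (- 1)%T
      (coord_at q (ext F [:: b; d]) (ext F [:: a; b])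
        *_[s] coord_at q (ext F [:: a; c]) (ext F [:: c; d]))%T
      (coord_at q (ext F [:: a; d]) (ext F [:: a; b])
        *_[s] coord_at q (ext F [:: b; c]) (ext F [:: c; d]))%T
}.

(* [Fa, Fb]_C is - X(a)^-1 X(b) for any suitable X in C; such an X exists and
   the value does not depend on it when C satisfies the first three circuit
   axioms and supports C is the set of circuits of N. *)
Definition circuit_coords (C : set {ffun E -> T}) (p : adj_bases N) : T :=
  xget 0%T
    [set t | exists F a b X,
       [/\ fresh F [:: a; b], val p = (ext F [:: a], ext F [:: b]), C X,
           [&& a \in supp X, b \in supp X & supp X \subset ext F [:: a; b]]
         & t = (- ((X a)^-1 *_[s] X b))%T]]%classic.

Definition coords_circuits (q : adj_bases N -> T) : set {ffun E -> T} :=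
  [set X | supp X \in circuits N /\
     forall F a b, fresh F [:: a; b] ->
       adjacent N (ext F [:: a], ext F [:: b]) ->
       a \in supp X -> b \in supp X -> supp X \subset ext F [:: a; b] ->
       ((X a)^-1 *_[s] X b = - coord_at q (ext F [:: a]) (ext F [:: b]))%T
  ]%classic.

End QuasiPlucker.

Definition underlying_matroid_is (E : finType) (T : skewTract)
    (C : set {ffun E -> T}) (N : matroid E) : Prop :=
  supports C = [set A | A \in circuits N]%classic.

(* Main.v *)
Require Import Defs.
From mathcomp Require Import boolp classical_sets.
From mathcomp Require Import finmap multiset.
From mathcomp Require Import all_boot.

(** Left multiplication leaves the ratios X(a)^-1 X(b) of a vector X unchanged, so
    the vectors on a circuit D are determined up to scaling by their ratios, and
    the coordinates of a matroid N record exactly these ratios, [Fa, Fb] being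
    read off the vector supported on the circuit in Fab. Two circuits form a
    modular pair iff their union has nullity 2. Modular
    elimination relates the vectors on three circuits of such a union, and this
    relation, read off at each point according to which of the relevant sets are
    bases, amounts to (P3), (P4) and (P5). Axioms
    (P1) and (P2) concern a single circuit, and together with the connectivity by
    exchanges of the bases of a contraction they make the prescribed ratios on a
    circuit consistent. *)

Set Implicit Arguments.
Unset Strict Implicit.
Unset Printing Implicit Defensive.

(** * Circuits, bases and modular pairs of a matroid *)

(** Products do not commute, so ratios multiply only when they match, as in X(a)^-1 X(b) times
    X(b)^-1 X(c). The factors in the axioms are ordered so that they telescope in this way, even
    across different vectors: where one of two eliminated vectors vanishes, the result agrees with
    the other. Only the sign moves freely, since [tract_eps] is central; hence [*_[s]] can carry the
    left and right versions together. A coordinate depends on F as well as on the circuit in Fab.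
    Given a vector, independence of F is automatic; given only coordinates, it has to be derived
    before any vector can be written down. Elimination asks for one Z that works at all points,
    whereas each axiom on coordinates speaks of a few points only. So Z has to be fixed beforehand,
    by its circuit and its value at a single point, and then checked point by point. *)

Section MatroidTheory.
Variables (E : finType) (N : matroid E).

Implicit Types (A B D S I : {set E}) (x y e : E).

Lemma aug_ext A B : A \in indep N -> B \in indep N -> #|A| <= #|B| ->
  exists I, [/\ I \in indep N, A \subset I, I \subset A :|: B & #|I| = #|B|].
Proof.
move=> iA iB; move en: (#|B| - #|A|) => n; elim: n A iA en => [|n IHn] A iA en leAB.
  exists A; split=> //; first exact: subsetUl.
  by apply/eqP; rewrite eqn_leq leAB /= -subn_eq0 en.
have ltAB : #|A| < #|B| by rewrite -subn_gt0 en.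
have [e] := indep_aug iA iB ltAB; rewrite inE => /andP[eNA eB] iAe.
have cAe : #|e |: A| = #|A|.+1 by rewrite cardsU1 eNA.
have [|| I [iI sAI sIB cI]] := IHn _ iAe; rewrite ?cAe //.
  by rewrite subnS en.
exists I; split=> //; first by apply: subset_trans sAI; apply: subsetUr.
apply: subset_trans sIB _; rewrite -setUA subUset subxx andbT.
by rewrite sub1set inE eB orbT.
Qed.

Lemma cardsD1S S x : x \in S -> #|S :\ x|.+1 = #|S|.
Proof. by move=> xS; rewrite [RHS](cardsD1 x) xS. Qed.

Lemma leq_rank A : A \in indep N -> #|A| <= rank N.
Proof. by move=> iA; rewrite /rank (bigmax_sup A). Qed.

Lemma exists_rank : exists2 B, B \in indep N & #|B| = rank N.
Proof.
have [|B iB cB] := @eq_bigmax_cond _ (mem (indep N)) (fun B : {set E} => #|B|).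
  by apply/card_gt0P; exists set0; apply: indep0.
by exists B; rewrite // -cB; apply: eq_bigl.
Qed.

Lemma basesE B : (B \in bases N) = (B \in indep N) && (#|B| == rank N).
Proof.
rewrite inE; apply/maxsetP/andP => [[iB maxB]|[iB /eqP cB]]; last first.
  split=> // A iA sBA; apply/eqP; rewrite eq_sym eqEcard sBA.
  by rewrite cB leq_rank.
split=> //; have [A iA cA] := exists_rank.
have [|I [iI sBI _ cI]] := aug_ext iB iA; first by rewrite cA leq_rank.
by rewrite -cA -cI (maxB I).
Qed.

Lemma base_indep B : B \in bases N -> B \in indep N.
Proof. by rewrite basesE => /andP[]. Qed.

Lemma base_card B : B \in bases N -> #|B| = rank N.
Proof. by rewrite basesE => /andP[_ /eqP]. Qed.

Lemma indep_base A B : A \in indep N -> B \in bases N ->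
  exists B', [/\ B' \in bases N, A \subset B' & B' \subset A :|: B].
Proof.
rewrite [B \in _]basesE => iA /andP[iB /eqP cB].
have [|I [iI sAI sIB cI]] := aug_ext iA iB; first by rewrite cB leq_rank.
by exists I; split=> //; rewrite basesE iI cI cB eqxx.
Qed.

Lemma exists_base : exists B, B \in bases N.
Proof. by have [B iB cB] := exists_rank; exists B; rewrite basesE iB cB eqxx. Qed.

Lemma dep_circuit A : A \notin indep N ->
  exists2 D, D \in circuits N & D \subset A.
Proof.
move=> dA; have [D mD sDA] := @minset_exists _ (fun A => A \notin indep N) A dA.
by exists D; rewrite ?inE.
Qed.

Lemma circuit_dep D : D \in circuits N -> D \notin indep N.
Proof. by rewrite inE => /minsetP[]. Qed.

Lemma circuit_proper D A : D \in circuits N -> A \proper D -> A \in indep N.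
Proof.
rewrite inE => /minsetP[_ minD] /andP[sAD sDA].
by apply: contraNT sDA => dA; rewrite (minD _ dA sAD).
Qed.

Lemma circuit_del D x : D \in circuits N -> x \in D -> D :\ x \in indep N.
Proof. by move=> cD xD; apply: (circuit_proper cD); apply: properD1. Qed.

Lemma circuit_sub D D' : D \in circuits N -> D' \in circuits N ->
  D \subset D' -> D = D'.
Proof.
rewrite [D' \in _]inE => cD /minsetP[_ minD'] sDD'.
exact: (minD' _ (circuit_dep cD)).
Qed.

Lemma circuit_neq0 D : D \in circuits N -> D != set0.
Proof.
by move=> cD; apply: contraNneq (circuit_dep cD) => ->; rewrite indep0.
Qed.

Lemma circuit_nsub D A : D \in circuits N -> A \in indep N -> ~~ (D \subset A).
Proof. by move=> cD iA; apply: contra (circuit_dep cD) => /indep_sub; apply. Qed.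

(** A circuit missing x would lie in the independent set [S :\ x]. This hypothesis, used throughout,
    says that S has nullity at most one; the sets Fab enter in this form. *)
Lemma mem_circuit S x D :
  S :\ x \in indep N -> D \in circuits N -> D \subset S -> x \in D.
Proof.
move=> iS cD sDS; apply: contraT => xD.
by have := circuit_nsub cD iS; rewrite subsetD1 sDS xD.
Qed.

(* If D2 were different from D1, a basis of D1 :|: D2 containing D2 minus a
   point f of D2 outside D1 would have to be (D1 :|: D2) :\ f, which contains
   D1. *)
Lemma circuit_uniq S x D1 D2 : S :\ x \in indep N ->
  D1 \in circuits N -> D2 \in circuits N -> D1 \subset S -> D2 \subset S ->
  D1 = D2.
Proof.
move=> iS c1 c2 s1 s2; have [/(circuit_sub c2 c1)->//|] := boolP (D2 \subset D1).
case/subsetPn=> f f2 f1; set U := D1 :|: D2.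
have sU : U \subset S by rewrite subUset s1.
have xU : x \in U by rewrite inE (mem_circuit iS c1 s1).
have iU : U :\ x \in indep N by apply: indep_sub iS; apply: setSD.
have i2 := circuit_del c2 f2.
have [|I [iI s2I sIU cI]] := aug_ext i2 iU.
  by rewrite -ltnS !cardsD1S // subset_leq_card ?subsetUr.
have fI : f \notin I.
  apply: contra (circuit_dep c2) => fI; apply: indep_sub iI.
  by rewrite -(setD1K f2) subUset sub1set fI.
have fU : f \in U by rewrite inE f2 orbT.
have eI : I = U :\ f.
  apply/eqP; rewrite eqEcard; apply/andP; split.
    rewrite subsetD1 fI andbT; apply: subset_trans sIU _.
    rewrite subUset (subset_trans (subD1set _ _)) ?subsetUr //.
    exact: subD1set.
  by rewrite cI -ltnS !cardsD1S.
case/negP: (circuit_dep c1); apply: indep_sub iI.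
by rewrite eI subsetD1 f1 subsetUl.
Qed.

(** A circuit inside [S :\ y] would be a second circuit of S, as D contains y. *)
Lemma indep_del S x y D : S :\ x \in indep N -> D \in circuits N ->
  D \subset S -> y \in D -> S :\ y \in indep N.
Proof.
move=> iS cD sD yD; apply: contraT => /dep_circuit[D' cD'].
rewrite subsetD1 => /andP[sD' yD'].
by rewrite (circuit_uniq iS cD' cD sD' sD) yD in yD'.
Qed.

Lemma base_del S x y D : S :\ x \in bases N -> D \in circuits N ->
  D \subset S -> y \in D -> S :\ y \in bases N.
Proof.
rewrite !basesE => /andP[iS /eqP <-] cD sD yD.
rewrite (indep_del iS cD sD yD) /= -eqSS !cardsD1S //.
  exact: (subsetP sD) (mem_circuit iS cD sD).
exact: (subsetP sD) yD.
Qed.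

Lemma base_circuit S x : x \in S -> S :\ x \in bases N ->
  exists2 D, D \in circuits N & D \subset S.
Proof.
move=> xS bS; apply: dep_circuit; apply: contraL (leqnn #|S|) => /leq_rank.
by rewrite -(base_card bS) -(cardsD1S xS) ltnn.
Qed.

(** A basis completing [D :\ x] cannot contain x, or D would be independent. This provides, for any
    two points of a circuit, a coordinate reading their ratio. *)
Lemma circuit_base D x : D \in circuits N -> x \in D ->
  exists S, D \subset S /\ S :\ x \in bases N.
Proof.
move=> cD xD; have [B bB] := exists_base.
have [B' [bB' sDB' _]] := indep_base (circuit_del cD xD) bB.
exists (x |: B'); split; first by rewrite -(setD1K xD) setUS.
rewrite setU1K //; apply: contra (circuit_dep cD) => xB'.
apply: indep_sub (base_indep bB').
by rewrite -(setD1K xD) subUset sub1set xB'.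
Qed.

(* Removing a point of B outside A that lies on a circuit in B lowers the
   nullity; the nullity of B is encoded as the least size of K with B :\: K
   independent. *)
Lemma indep_step A B D e (K : {set E}) : B :\: K \in indep N -> A \subset B ->
  D \in circuits N -> D \subset B -> e \in D -> e \notin A ->
  exists2 K' : {set E}, #|K'| < #|K| & A :\: K' \in indep N.
Proof.
move=> iB sAB cD sDB eD eA; have iD := circuit_del cD eD.
have [I [iI sDI sIB cI]] : exists I, [/\ I \in indep N, D :\ e \subset I,
    I \subset B & #|B :\: K| <= #|I|].
  have [le|/ltnW le] := leqP #|D :\ e| #|B :\: K|.
    have [I [iI sDI sIB cI]] := aug_ext iD iB le.
    exists I; split; rewrite ?cI //; apply: subset_trans sIB _.
    by rewrite subUset subsetDl (subset_trans (subD1set _ _)).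
  by exists (D :\ e); split=> //; apply: subset_trans sDB; apply: subD1set.
have eI : e \notin I.
  apply: contra (circuit_dep cD) => eI; apply: indep_sub iI.
  by rewrite -(setD1K eD) subUset sub1set eI.
have eBI : e \in B :\: I by rewrite inE eI (subsetP sDB).
(* [B :\: I] has at most [#|K|] points and e is one of them; dropping e is harmless because e lies
   outside A. *)
exists ((B :\: I) :\ e).
  rewrite cardsD1S // cardsDS // leq_subLR.
  rewrite -(cardsID K B) addnC leq_add // subset_leq_card //.
  exact: subsetIr.
apply: indep_sub iI; apply/subsetP=> x; rewrite !inE negb_and negbK.
case/andP=> /orP[/eqP->|]; first by rewrite (negPf eA).
by case: (x \in I) => //= xB /(subsetP sAB); rewrite (negPf xB).
Qed.

(** * Heights in the lattice of unions of circuits *)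

Local Notation circs := [set A | A \in circuits N]%classic.

Lemma union_latticeP A x : union_lattice circs A -> x \in A ->
  exists D, [/\ D \in circuits N, D \subset A & x \in D].
Proof.
case=> S SC -> /bigcupP[D DS xD]; exists D; split=> //; first exact: SC.
exact: bigcup_sup.
Qed.

Lemma union_lattice1 D : D \in circuits N -> union_lattice circs D.
Proof.
move=> cD; exists [set D]; first by move=> B /set1P->.
by rewrite /cover big_set1.
Qed.

Lemma union_latticeU A B :
  union_lattice circs A -> union_lattice circs B -> union_lattice circs (A :|: B).
Proof.
move=> [S SC ->] [S' SC' ->]; exists (S :|: S').
  by move=> D /setUP[/SC|/SC'].
by rewrite /cover bigcup_setU.
Qed.

(** Going down from the top of the chain, each proper step loses a point that lies on a circuit of
    the larger set, since that set is a union of circuits; [indep_step] then shrinks K. *)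
Lemma chain_size A (K : {set E}) s : A :\: K \in indep N ->
  chain_to (union_lattice circs) A s -> size s <= #|K|.
Proof.
elim/last_ind: s A K => [|s B IHs] A K iA [sU]; first by [].
rewrite rcons_path last_rcons => /andP[ps pB] eBA; subst A.
have UB : union_lattice circs B by apply: sU; rewrite mem_rcons inE eqxx.
have [sAB /subsetPn[e eB eA]] := andP pB.
have [D [cD sDB eD]] := union_latticeP UB eB.
have [K' ltK iK'] := indep_step iA sAB cD sDB eD eA.
rewrite size_rcons; apply: leq_ltn_trans ltK; apply: (IHs _ _ iK').
by split=> // D' D's; apply: sU; rewrite mem_rcons inE D's orbT.
Qed.

(** The chain [D1], [D1 :|: D2] has length 2, and [chain_size] with K excludes longer ones. *)
Lemma modular_pairI S (K : {set E}) D1 D2 : S :\: K \in indep N -> #|K| <= 2 ->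
  D1 \in circuits N -> D2 \in circuits N -> D1 \subset S -> D2 \subset S ->
  D1 <> D2 -> modular_pair circs D1 D2.
Proof.
move=> iS cK c1 c2 s1 s2 D12; split=> //; split.
  have U1 := union_lattice1 c1.
  exists [:: D1; D1 :|: D2]; last by [].
  split=> //; first move=> B; rewrite ?inE.
    case/orP=> /eqP-> //; apply: union_latticeU => //; exact: union_lattice1.
  rewrite /= andbT properE sub0set subset0 circuit_neq0 //= properE subsetUl /=.
  rewrite subUset subxx /=; apply/negP=> /(circuit_sub c2 c1) e.
  by case: D12.
move=> s /(chain_size (K := K)) H; apply: leq_trans cK; apply: H.
by apply: indep_sub iS; apply: setSD; rewrite subUset s1.
Qed.

(* A circuit avoiding c and d would start a chain of length 3. *)
Lemma modular_pair_indep D1 D2 c d : modular_pair circs D1 D2 ->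
  c \in D1 :\: D2 -> d \in D2 :\: D1 -> (D1 :|: D2) :\ c :\ d \in indep N.
Proof.
case=> c1 c2 _ [_ hmax]; rewrite !inE => /andP[cN2 cD1] /andP[dN1 dD2].
apply: contraT => /dep_circuit[D cD]; rewrite !subsetD1.
case/andP=> /andP[sDU cND] dND.
have UD := union_lattice1 cD; have U1 := union_lattice1 c1.
have U2 := union_lattice1 c2; have UD2 := union_latticeU UD U2.
suff: chain_to (union_lattice circs) (D1 :|: D2) [:: D; D :|: D2; D1 :|: D2].
  by move/hmax.
split=> //.
  move=> B; rewrite !inE => /or3P[] /eqP-> //; exact: union_latticeU.
rewrite /= andbT; apply/and3P; split.
- by rewrite properE sub0set subset0 circuit_neq0.
- rewrite properE subsetUl subUset negb_and; apply/orP; right.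
  by apply/subsetPn; exists d.
- rewrite properE subUset sDU subsetUr subUset negb_and /=; apply/orP; left.
  by apply/subsetPn; exists c; rewrite // inE negb_or cND.
Qed.

Lemma modular_pair_neq D1 D2 : modular_pair circs D1 D2 ->
  (exists c, c \in D1 :\: D2) /\ (exists d, d \in D2 :\: D1).
Proof.
case=> c1 c2 D12 _; split; apply/set0Pn; rewrite setD_eq0; apply/negP=> sD.
  by apply: D12; apply: circuit_sub sD.
by apply: D12; apply/esym; apply: circuit_sub sD.
Qed.

End MatroidTheory.

(** * Skew tracts *)

Section TractTheory.
Variable T : skewTract.
Local Open Scope tract_scope.
Local Notation G := (tract_group T).
Implicit Types (g h : G) (x y z : T) (s : side).

Lemma lact_seq g (t : seq G) :
  lact g (seq_mset t) = seq_mset [seq (g * h)%g | h <- t].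
Proof. by apply/eq_seq_msetP/perm_map/perm_eq_seq_mset. Qed.

Lemma ract_seq g (t : seq G) :
  ract g (seq_mset t) = seq_mset [seq (h * g)%g | h <- t].
Proof. by apply/eq_seq_msetP/perm_map/perm_eq_seq_mset. Qed.

Lemma seq_mset_nil : seq_mset [::] = mset0 :> {mset G}%mset.
Proof. by apply/msetP=> g; rewrite mset_seqE mset0E. Qed.

(** [pmap id] drops the zero terms, so that case analysis on the terms leaves an explicit list of
    group elements. *)
Lemma null_sum3E x y z : null_sum3 x y z = null (seq_mset (pmap id [:: x; y; z])).
Proof.
by congr null; case: x y z => [x|] [y|] [z|];
  rewrite /= ?mset_cons seq_mset_nil ?msetD0 ?mset0D ?msetDA.
Qed.

Lemma null_seq_mull g (t : seq G) :
  null (seq_mset t) -> null (seq_mset [seq (g * h)%g | h <- t]).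
Proof. by rewrite -lact_seq; apply: null_lact. Qed.

Lemma null_seq_mulr g (t : seq G) :
  null (seq_mset t) -> null (seq_mset [seq (h * g)%g | h <- t]).
Proof. by rewrite -ract_seq; apply: null_ract. Qed.

Lemma null_perm (t t' : seq G) :
  perm_eq t t' -> null (seq_mset t) -> null (seq_mset t').
Proof. by move=> /eq_seq_msetP ->. Qed.

Lemma null_one_eps g : null (seq_mset [:: 1%g; g]) -> g = tract_eps T.
Proof.
by rewrite !mset_cons seq_mset_nil msetD0; apply: eps_unique.
Qed.

Lemma null_eps_seq : null (seq_mset [:: 1%g; tract_eps T]).
Proof. by rewrite !mset_cons seq_mset_nil msetD0; apply: null_eps. Qed.

(** Conjugating 1 + eps by g gives a null sum of the same form, and eps is unique. *)
Lemma eps_central g : (tract_eps T * g = g * tract_eps T)%g.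
Proof.
have /= := null_seq_mulr g (null_seq_mull g^-1 null_eps_seq).
by rewrite mulg1 mulVg => /null_one_eps e; rewrite -[in RHS]e !mulgA mulgV mul1g.
Qed.

(** Multiplying 1 + eps by the inverse of eps shows that this inverse also satisfies the property
    defining eps. *)
Lemma eps_invol : (tract_eps T * tract_eps T = 1)%g.
Proof.
have /= := null_seq_mull (tract_eps T)^-1 null_eps_seq.
rewrite mulg1 mulVg => H.
have e := null_one_eps
  (null_perm (permEl (perm_catC [:: (tract_eps T)^-1%g] [:: 1%g])) H).
by rewrite -[X in (X * _)%g]e mulVg.
Qed.

Lemma null_singleton g : ~ null (seq_mset [:: g]).
Proof.
move=> /(null_seq_mull g^-1) /=; rewrite mulVg mset_cons seq_mset_nil msetD0.
exact: null1.
Qed.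

Lemma null_pair g h : null (seq_mset [:: g; h]) <-> h = (tract_eps T * g)%g.
Proof.
split=> [/(null_seq_mull g^-1) /=|->].
  rewrite mulVg => /null_one_eps e.
  by rewrite eps_central -e mulgA mulgV mul1g.
by have /= := null_seq_mulr g null_eps_seq; rewrite mul1g.
Qed.

Lemma null_sum3C x y z : null_sum3 x y z -> null_sum3 y x z.
Proof. by rewrite /null_sum3 [(formal x `+` _)%mset]msetDC. Qed.

Lemma null_sum3R x y z : null_sum3 x y z -> null_sum3 y z x.
Proof. by rewrite /null_sum3 -msetDA msetDC. Qed.

Lemma null_sum3_smul s w x y z : null_sum3 x y z ->
  null_sum3 (w *_[s] x) (w *_[s] y) (w *_[s] z).
Proof.
rewrite !null_sum3E; case: w => [g|]; last first.
  by move=> _; case: s x y z => [] [x|] [y|] [z|]; rewrite /= seq_mset_nil; apply: null0.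
case: s => [/(null_seq_mull g)|/(null_seq_mulr g)];
  by case: x y z => [x|] [y|] [z|].
Qed.

(** Zero entries are covered too: the empty sum is null, and a single group element never is, since
    the action would carry it to 1. *)
Lemma null_sum30 x y : null_sum3 x y 0 <-> y = - x.
Proof.
rewrite null_sum3E; case: x y => [g|] [h|] /=; split=> //.
- by move/null_pair->.
- by case=> ->; apply/null_pair.
- by move/null_singleton.
- by move/null_singleton.
- by move=> _; rewrite seq_mset_nil; apply: null0.
Qed.

Lemma smulA s x y z : x *_[s] (y *_[s] z) = x *_[s] y *_[s] z.
Proof. by case: s x y z => [] [x|] [y|] [z|] //=; rewrite mulgA. Qed.

Lemma smul1l s x : 1 *_[s] x = x.
Proof. by case: s x => [] [x|] //=; rewrite ?mul1g ?mulg1. Qed.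

Lemma smul1r s x : x *_[s] 1 = x.
Proof. by case: s x => [] [x|] //=; rewrite ?mul1g ?mulg1. Qed.

Lemma smul0r s x : x *_[s] 0 = 0.
Proof. by case: s x => [] [x|]. Qed.

Lemma smulVl s x : x != 0 -> x^-1 *_[s] x = 1.
Proof. by case: s x => [] [x|] //= _; rewrite ?mulVg ?mulgV. Qed.

Lemma smulVr s x : x != 0 -> x *_[s] x^-1 = 1.
Proof. by case: s x => [] [x|] //= _; rewrite ?mulVg ?mulgV. Qed.

Lemma smulK s x y : y != 0 -> x *_[s] y *_[s] y^-1 = x.
Proof. by move=> y0; rewrite -smulA smulVr ?smul1r. Qed.

Lemma smulVK s x y : y != 0 -> x *_[s] y^-1 *_[s] y = x.
Proof. by move=> y0; rewrite -smulA smulVl ?smul1r. Qed.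

Lemma smulI s x y z : x != 0 -> x *_[s] y = x *_[s] z -> y = z.
Proof.
move=> x0 /(congr1 (smul s x^-1)).
by rewrite !smulA smulVl // !smul1l.
Qed.

Lemma smulNl s x y : - x *_[s] y = - (x *_[s] y).
Proof.
by case: s x y => [] [x|] [y|] //=; rewrite /topp /= !mulgA -?eps_central.
Qed.

Lemma smulNr s x y : x *_[s] - y = - (x *_[s] y).
Proof.
by case: s x y => [] [x|] [y|] //=; rewrite /topp /= !mulgA -?eps_central.
Qed.

Lemma toppK x : - - x = x.
Proof. by case: x => [x|] //; rewrite /topp /= mulgA eps_invol mul1g. Qed.

Lemma topp_inj x y : - x = - y -> x = y.
Proof. by move/(congr1 (@topp T)); rewrite !toppK. Qed.

Lemma topp_eq0 x : (- x == 0) = (x == 0).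
Proof. by case: x. Qed.

Lemma tinv_neq0 x : (x^-1 != 0) = (x != 0).
Proof. by case: x. Qed.

Lemma smul_neq0 s x y : (x *_[s] y != 0) = (x != 0) && (y != 0).
Proof. by case: s x y => [] [x|] [y|]. Qed.

Lemma tinvM s x y : (x *_[s] y)^-1 = y^-1 *_[s] x^-1.
Proof. by case: s x y => [] [x|] [y|] //=; rewrite invgM. Qed.

Lemma tinvN x : (- x)^-1 = - x^-1.
Proof.
case: x => [x|] //; rewrite /topp /= invgM eps_central; congr (Some (_ * _)%g).
by apply: (mulgI (tract_eps T)); rewrite mulgV eps_invol.
Qed.

End TractTheory.

Ltac split_andb :=
  repeat match goal with H : is_true (_ && _) |- _ => case/andP: H => ? ? end.

(* Decides an equality of finite sets built from F and distinct points outside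
   F, by running through all the coincidences of a generic point. *)
Ltac set_cases :=
  split_andb;
  apply/setP; let z := fresh "z" in intro z; rewrite !inE;
  repeat match goal with
  | |- context [z == ?a] =>
    let H := fresh in destruct (eqVneq z a) as [H|H]; [subst z|]
  end;
  repeat match goal with
  | H : is_true (?x != ?y) |- context [?x == ?y] => rewrite (negPf H)
  | H : is_true (?x != ?y) |- context [?y == ?x] => rewrite [y == x]eq_sym (negPf H)
  | H : is_true (?x \notin ?F) |- context [?x \in ?F] => rewrite (negPf H)
  | H : is_true (?x \in ?F) |- context [?x \in ?F] => rewrite H
  end;
  rewrite ?eqxx ?andbT ?orbT ?andbF ?orbF //=;
  repeat match goal with |- context [?x \in ?A] => case: (x \in A) end => //.

Ltac ext_perm := apply/setP=> ?; rewrite !inE; repeat case: (_ == _); rewrite ?orbT.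

(** * Quasi-Plücker coordinates and circuits *)

Section Coordinates.
Variables (s : side) (E : finType) (N : matroid E) (T : skewTract).
Local Open Scope tract_scope.
Implicit Types (X Y Z : {ffun E -> T}) (S F B : {set E}) (a b c d e f : E).

Lemma null_sum3_l0 (x y z : T) : x = 0 -> null_sum3 x y (- z) -> z = y.
Proof. by move=> -> /null_sum3R/null_sum30/topp_inj. Qed.

Lemma null_sum3_m0 (x y z : T) : y = 0 -> null_sum3 x y (- z) -> z = x.
Proof. by move=> -> /null_sum3C; apply: null_sum3_l0. Qed.

Lemma suppE X e : (e \in supp X) = (X e != 0).
Proof. by rewrite inE. Qed.

Lemma suppPn X e : e \notin supp X -> X e = 0.
Proof. by rewrite suppE negbK => /eqP. Qed.

Lemma notin_supp X S e : supp X \subset S -> e \notin S -> X e = 0.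
Proof. by move=> /subsetP sXS eS; apply: suppPn; apply: contra eS => /sXS. Qed.

Lemma supp_scale (x : T) X : x != 0 -> supp (scale s x X) = supp X.
Proof. by move=> x0; apply/setP=> e; rewrite !suppE ffunE smul_neq0 x0. Qed.

Lemma adjacentD1 S a b : a \in S -> b \in S -> a != b ->
  S :\ b \in bases N -> S :\ a \in bases N -> adjacent N (S :\ b, S :\ a).
Proof.
move=> aS bS ab bb ba; rewrite /adjacent bb ba /=.
suff -> : (S :\ b) :\: (S :\ a) = [set a] by rewrite cards1.
by set_cases.
Qed.

Lemma coord_at_val (q : adj_bases N -> T) B B' (adj : adjacent N (B, B')) :
  coord_at q B B' = q (exist _ (B, B') adj).
Proof. by rewrite /coord_at (insubT (adjacent N) adj). Qed.

Lemma ext1E S F a b : fresh F [:: a; b] -> S = ext F [:: a; b] ->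
  S :\ b = ext F [:: a] /\ S :\ a = ext F [:: b].
Proof.
rewrite /fresh /= !inE => fr ->; split; set_cases.
Qed.

Lemma ext2E S a b : a \in S -> b \in S -> a != b ->
  fresh (S :\ a :\ b) [:: a; b] /\ ext (S :\ a :\ b) [:: a; b] = S.
Proof.
move=> aS bS ab; split; first by rewrite /fresh /= !inE ab !eqxx /= ?andbF.
set_cases.
Qed.

Lemma dep_of_nbase F a b : #|F|.+2 = rank N -> ext F [:: a; b] \notin bases N ->
  fresh F [:: a; b] -> ext F [:: a; b] \notin indep N.
Proof.
move=> rF nb fr; apply: contra nb => ib; rewrite basesE ib /= -rF.
move: fr; rewrite /fresh /= !inE => /andP[/andP[ab _] /and3P[aF bF _]].
have -> : ext F [:: a; b] = a |: (b |: F).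
  by apply/setP=> z; rewrite !inE; case: (z \in F); rewrite ?orbT ?orbF.
by rewrite !cardsU1 !inE negb_or ab aF bF.
Qed.

Lemma coords_circuitsP (q : adj_bases N -> T) X :
  coords_circuits s q X <->
  supp X \in circuits N /\
  forall S a b, a \in supp X -> b \in supp X -> a != b -> supp X \subset S ->
    S :\ b \in bases N ->
    (X a)^-1 *_[s] X b = - coord_at q (S :\ b) (S :\ a).
Proof.
split=> -[cX qX]; split=> //.
  move=> S a b aX bX ab sXS bb.
  have [aS bS] := (subsetP sXS _ aX, subsetP sXS _ bX).
  have [fr eS] := ext2E aS bS ab; have [eb ea] := ext1E fr (esym eS).
  have := qX _ _ _ fr; rewrite -eb -ea eS; apply=> //; apply: adjacentD1 => //.
  exact: base_del bb cX sXS aX.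
move=> F a b fr adj aX bX sX; have [eb ea] := ext1E fr erefl.
have ab : a != b by move: fr; rewrite /fresh /= !inE; case/andP=> /andP[].
by rewrite -eb -ea; apply: qX; rewrite // eb; case/andP: adj.
Qed.

Lemma coordsE (q : adj_bases N -> T) X S a b B B' : coords_circuits s q X ->
  a \in supp X -> b \in supp X -> a != b -> supp X \subset S ->
  B \in bases N -> B = S :\ b -> B' = S :\ a ->
  coord_at q B B' = - ((X a)^-1 *_[s] X b).
Proof.
move=> /coords_circuitsP[_ qX] aX bX ab sX bB eB ->; rewrite eB in bB *.
by rewrite (qX S) ?toppK.
Qed.

(** The factor is read off at one point e. For any other f of the circuit, a set S from
    [circuit_base] makes the ratios of X and Y between e and f the same coordinate. *)
Lemma coords_scale (q : adj_bases N -> T) X Y :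
  coords_circuits s q X -> coords_circuits s q Y -> supp X = supp Y ->
  exists2 x : T, x != 0 & Y = scale s x X.
Proof.
move=> /coords_circuitsP[cX qX] /coords_circuitsP[_ qY] eXY.
have /set0Pn[e eX] := circuit_neq0 cX.
have eY : e \in supp Y by rewrite -eXY.
exists (Y e *_[s] (X e)^-1).
  by rewrite smul_neq0 tinv_neq0 -!suppE eX eY.
rewrite suppE in eY; apply/ffunP=> f; rewrite ffunE.
have [->|fe] := eqVneq f e; first by rewrite smulVK // -suppE.
have [fX|fX] := boolP (f \in supp X); last first.
  by rewrite (suppPn fX) smul0r suppPn -?eXY.
have [S [sXS bS]] := circuit_base cX fX.
rewrite eq_sym in fe; have fY : f \in supp Y by rewrite -eXY.
apply: (@smulI _ s (Y e)^-1); first by rewrite tinv_neq0.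
rewrite (qY S) -?eXY // ?suppE ?eY ?eX -?suppE // -(qX S) //.
by rewrite !smulA smulVl ?smul1l.
Qed.

Lemma coords_scaled (q : adj_bases N -> T) (x : T) X : x != 0 ->
  coords_circuits s q X -> coords_circuits s q (scale s x X).
Proof.
move=> x0 /coords_circuitsP[cX qX]; apply/coords_circuitsP.
rewrite supp_scale //; split=> // S a b aX bX ab sXS bb.
by rewrite !ffunE tinvM -(qX S) // !smulA smulVK.
Qed.

(** * From a weak matroid to its coordinates *)

Section WeakMatroidCoordinates.
Variable C : set {ffun E -> T}.
Hypothesis wC : weak_matroid s C.
Hypothesis uC : underlying_matroid_is C N.

Lemma supp_circuit X : C X -> supp X \in circuits N.
Proof.
move=> CX; have : supports C (supp X) by exists X.
by rewrite uC.
Qed.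

Lemma circuit_supp D : D \in circuits N -> exists2 X, C X & supp X = D.
Proof.
by move=> cD; have : supports C D by rewrite uC.
Qed.

Lemma base_supp S x : x \in S -> S :\ x \in bases N ->
  exists2 X, C X & supp X \subset S.
Proof.
move=> xS bS; have [D /circuit_supp[X CX <-] sDS] := base_circuit xS bS.
by exists X.
Qed.

Lemma ratio_uniq X Y S x a b : C X -> C Y -> S :\ x \in indep N ->
  supp X \subset S -> supp Y \subset S -> a \in supp X ->
  (X a)^-1 *_[s] X b = (Y a)^-1 *_[s] Y b.
Proof.
move=> CX CY iS sX sY aX.
have e := circuit_uniq iS (supp_circuit CX) (supp_circuit CY) sX sY.
have [|x0 /eqP nx0 ->] := circ_incomparable wC CX CY; first by rewrite e.
by rewrite !ffunE tinvM !smulA smulVK.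
Qed.

Lemma circuit_coordsE X S a b : C X -> a \in supp X -> b \in supp X ->
  a != b -> supp X \subset S -> S :\ b \in bases N ->
  coord_at (circuit_coords s C : adj_bases N -> T) (S :\ b) (S :\ a) =
    - ((X a)^-1 *_[s] X b).
Proof.
move=> CX aX bX ab sXS bb.
have [aS bS] := (subsetP sXS _ aX, subsetP sXS _ bX).
have adj : adjacent N (S :\ b, S :\ a).
  by apply: adjacentD1 => //; apply: base_del bb (supp_circuit CX) sXS aX.
rewrite (coord_at_val _ adj) /circuit_coords.
set P := (P in xget _ P).
have [] : P (xget 0 P).
  apply: xgetPex; exists (- ((X a)^-1 *_[s] X b)).
  have [fr eS] := ext2E aS bS ab; have [eb ea] := ext1E fr (esym eS).
  by exists (S :\ a :\ b), a, b, X; split; rewrite //= ?eS -?eb -?ea // aX bX.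
(* The triple chosen by [xget] may involve another vector Y, but its points must be a and b, where
   the two bases differ; [ratio_uniq] then compares Y with X. *)
move=> F [a' [b' [Y [fr [eb ea] CY /and3P[aY bY sY] ->]]]].
have ea1 : a = a'.
  have : a \notin S :\ a by rewrite !inE eqxx.
  have : a \in S :\ b by rewrite !inE ab.
  by rewrite ea eb !inE => /orP[->|/eqP].
have eb1 : b = b'.
  have : b \notin S :\ b by rewrite !inE eqxx.
  have : b \in S :\ a by rewrite !inE eq_sym ab.
  by rewrite ea eb !inE => /orP[->|/eqP].
subst a' b'; congr (- _); apply/esym.
apply: (ratio_uniq b CX CY (base_indep bb) sXS _ aX).
by rewrite -(setD1K bS) eb; apply: subset_trans sY _; apply/subsetP=> z;
  rewrite !inE => /or3P[] ->; rewrite ?orbT.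
Qed.

(** Members of C have the right ratios. Conversely, a vector with these ratios lives on a circuit
    that carries a member of C, hence is a multiple of it. *)
Lemma coords_circuitsE (q : adj_bases N -> T) : q = circuit_coords s C ->
  C = coords_circuits s q.
Proof.
move=> ->.
have sub X : C X -> coords_circuits s (circuit_coords s C : adj_bases N -> T) X.
  move=> CX; apply/coords_circuitsP; split; first exact: supp_circuit.
  by move=> S a b aX bX ab sX bb; rewrite (circuit_coordsE CX) // toppK.
apply/seteqP; split=> // X qX; have cX : supp X \in circuits N by case: qX.
have [Y CY eY] := circuit_supp cX.
have [x /eqP x0 ->] := coords_scale (sub _ CY) qX eY.
exact: (circ_scale wC).
Qed.

(** Y is rescaled so that it cancels X at e. Outside S both vectors vanish, which forces Z to vanish
    there as well. *)
Lemma supp_elim S (K : {set E}) X Y e : C X -> C Y ->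
  S :\: K \in indep N -> #|K| <= 2 ->
  supp X \subset S -> supp Y \subset S -> supp X <> supp Y ->
  e \in supp X -> e \in supp Y ->
  exists Y' Z, [/\ C Y', supp Y' = supp Y, C Z, supp Z \subset S :\ e &
    [/\ X e = - Y' e & forall f, null_sum3 (X f) (Y' f) (- Z f)]].
Proof.
move=> CX CY iK cK sX sY nXY eX eY.
rewrite suppE in eX; rewrite suppE in eY.
pose x : T := - X e *_[s] (Y e)^-1.
have x0 : x != 0 by rewrite smul_neq0 topp_eq0 tinv_neq0 eX.
have CY' := circ_scale wC CY (elimN eqP x0).
have XY'e : X e = - scale s x Y e by rewrite ffunE smulVK // toppK.
have XY : modular_pair (supports C) (supp X) (supp (scale s x Y)).
  rewrite supp_scale // uC.
  exact: modular_pairI iK cK (supp_circuit CX) (supp_circuit CY) sX sY nXY.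
have [Z [CZ Ze nZ]] := circ_modular_elim wC CX CY' XY XY'e (elimN eqP eX).
exists (scale s x Y), Z; split; rewrite ?supp_scale //.
rewrite subsetD1 suppE Ze eqxx andbT; apply/subsetP=> f; apply: contraLR => fS.
have := nZ f; rewrite (notin_supp sX fS) ffunE (notin_supp sY fS) smul0r.
by move/(null_sum3_l0 erefl) => e0; rewrite suppE e0 eqxx.
Qed.

Lemma mem_supp S x X : C X -> S :\ x \in indep N -> supp X \subset S -> x \in supp X.
Proof. by move=> CX iS; apply: mem_circuit iS (supp_circuit CX). Qed.

Variable q : adj_bases N -> T.
Hypothesis qC : q = circuit_coords s C.

Lemma coordE X S a b B B' : C X -> supp X \subset S -> a != b ->
  B \in bases N -> B' \in bases N -> B = S :\ b -> B' = S :\ a ->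
  coord_at q B B' = - ((X a)^-1 *_[s] X b).
Proof.
move=> CX sX ab bB bB' eB eB'; have qX := CX; rewrite (coords_circuitsE qC) in qX.
apply: (coordsE qX _ _ ab sX bB eB eB').
  by apply: (mem_supp CX _ sX); rewrite -eB'; apply: base_indep.
by apply: (mem_supp CX _ sX); rewrite -eB; apply: base_indep.
Qed.

Lemma circuit_coords_qp1 F a b : fresh F [:: a; b] ->
  ext F [:: a] \in bases N -> ext F [:: b] \in bases N ->
  coord_at q (ext F [:: a]) (ext F [:: b])
    *_[s] coord_at q (ext F [:: b]) (ext F [:: a]) = 1.
Proof.
move=> fr ba bb; have [eb ea] := ext1E fr erefl.
have [||X CX sX] := @base_supp (ext F [:: a; b]) b; rewrite ?eb //.
  by rewrite !inE eqxx !orbT.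
have aX : a \in supp X by apply: (mem_supp CX _ sX); rewrite ea base_indep.
have bX : b \in supp X by apply: (mem_supp CX _ sX); rewrite eb base_indep.
have ab : a != b by move: fr; rewrite /fresh /= !inE; case/andP=> /andP[].
rewrite (coordE CX sX ab ba bb) //.
rewrite (coordE CX sX _ bb ba (esym ea) (esym eb)) // 1?eq_sym //.
by rewrite smulNl smulNr toppK !smulA smulK -?suppE // smulVl -?suppE.
Qed.

(** All three coordinates come from the one vector in Fabc; its ratios telescope to 1 and three
    signs remain. *)
Lemma circuit_coords_qp2 F a b c : fresh F [:: a; b; c] ->
  ext F [:: a; b] \in bases N -> ext F [:: a; c] \in bases N ->
  ext F [:: b; c] \in bases N ->
  coord_at q (ext F [:: a; c]) (ext F [:: b; c])
    *_[s] coord_at q (ext F [:: a; b]) (ext F [:: a; c])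
    *_[s] coord_at q (ext F [:: b; c]) (ext F [:: a; b]) = - 1.
Proof.
move=> fr bab bac bbc; rewrite /fresh /= !inE !negb_or in fr.
have eab : ext F [:: a; b] = ext F [:: a; b; c] :\ c by set_cases.
have eac : ext F [:: a; c] = ext F [:: a; b; c] :\ b by set_cases.
have ebc : ext F [:: b; c] = ext F [:: a; b; c] :\ a by set_cases.
have [||X CX sX] := @base_supp (ext F [:: a; b; c]) c; rewrite -?eab //.
  by rewrite !inE eqxx !orbT.
have aX : a \in supp X by apply: (mem_supp CX _ sX); rewrite -ebc base_indep.
have bX : b \in supp X by apply: (mem_supp CX _ sX); rewrite -eac base_indep.
have cX : c \in supp X by apply: (mem_supp CX _ sX); rewrite -eab base_indep.
case/and3P: fr => /and3P[/andP[ab ac] bc _] _ _.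
rewrite (coordE CX sX ab bac bbc eac ebc) (coordE CX sX bc bab bac eab eac).
rewrite (coordE CX sX _ bbc bab ebc eab) 1?eq_sym //.
rewrite !smulNl !smulNr !smulNl toppK !smulA.
by rewrite !smulK -?suppE // smulVl -?suppE.
Qed.

(* Eliminating a between the vectors supported in Fab and Fac gives the vector
   supported in Fbc. *)
Lemma circuit_coords_qp3 F a b c : fresh F [:: a; b; c] ->
  ext F [:: a] \in bases N -> ext F [:: b] \in bases N ->
  ext F [:: c] \in bases N ->
  coord_at q (ext F [:: a]) (ext F [:: b])
    *_[s] coord_at q (ext F [:: b]) (ext F [:: c])
    *_[s] coord_at q (ext F [:: c]) (ext F [:: a]) = 1.
Proof.
move=> fr ba bb bc; rewrite /fresh /= !inE !negb_or in fr.
have eab : ext F [:: a] = ext F [:: a; b] :\ b by set_cases.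
have eba : ext F [:: b] = ext F [:: a; b] :\ a by set_cases.
have eac : ext F [:: a] = ext F [:: a; c] :\ c by set_cases.
have eca : ext F [:: c] = ext F [:: a; c] :\ a by set_cases.
have ebc : ext F [:: b] = ext F [:: b; c] :\ c by set_cases.
have ecb : ext F [:: c] = ext F [:: b; c] :\ b by set_cases.
have eK : ext F [:: a; b; c] :\: [set b; c] = ext F [:: a] by set_cases.
have ea : ext F [:: a; b; c] :\ a = ext F [:: b; c] by set_cases.
have sb : ext F [:: a; b; c] :\ c = ext F [:: a; b] by set_cases.
have sc : ext F [:: a; b; c] :\ b = ext F [:: a; c] by set_cases.
case/and3P: fr => /and3P[/andP[ab ac] nbc _] _ /and3P[bF cF _].
have ca : c != a by rewrite eq_sym.
have [||X CX sX] := @base_supp (ext F [:: a; b]) b; rewrite -?eab //.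
  by rewrite !inE eqxx !orbT.
have [||Y CY sY] := @base_supp (ext F [:: a; c]) c; rewrite -?eac //.
  by rewrite !inE eqxx !orbT.
have aX : a \in supp X by apply: (mem_supp CX _ sX); rewrite -eba base_indep.
have aY : a \in supp Y by apply: (mem_supp CY _ sY); rewrite -eca base_indep.
have bX : b \in supp X by apply: (mem_supp CX _ sX); rewrite -eab base_indep.
have bY : b \notin ext F [:: a; c] by rewrite -sc !inE eqxx.
have cX : c \notin ext F [:: a; b] by rewrite -sb !inE eqxx.
have [|||||V [W [CV sV CW]]] := supp_elim CX CY _ _ _ _ _ aX aY
  (S := ext F [:: a; b; c]) (K := [set b; c]).
- by rewrite eK base_indep.
- by rewrite cards2 nbc.
- by rewrite -sb in sX; apply: subset_trans sX (subD1set _ _).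
- by rewrite -sc in sY; apply: subset_trans sY (subD1set _ _).
- by move=> e; rewrite e in bX; rewrite (subsetP sY _ bX) in bY.
rewrite ea => sW [Xa nW]; rewrite -sV in sY aY.
(* Y and its multiple V vanish at b, and X vanishes at c, so W agrees with X at b and with V at c,
   and the three ratios telescope. The relation between X and V at a supplies a fourth sign. *)
have Wb := null_sum3_m0 (notin_supp sY bY) (nW b).
have Wc := null_sum3_l0 (notin_supp sX cX) (nW c).
have cV : c \in supp V by apply: (mem_supp CV _ sY); rewrite -eac base_indep.
rewrite (coordE CX sX ab ba bb eab eba) (coordE CW sW nbc bb bc ebc ecb).
rewrite (coordE CV sY ca bc ba eca eac) Wb Wc Xa.
rewrite tinvN !smulNl !smulNr !smulNl !toppK !smulA.
by rewrite !smulK -?suppE // smulVl -?suppE.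
Qed.

(* If the vectors X in Fabc and Y in Fabd have distinct supports, then Fcd is not
   a basis, and the vector eliminating a between them vanishes at b since its
   support lies in Fcd. *)
Lemma circuit_coords_qp4 F a b c d : fresh F [:: a; b; c; d] ->
  #|F|.+2 = rank N ->
  ext F [:: a; c] \in bases N -> ext F [:: a; d] \in bases N ->
  ext F [:: b; c] \in bases N -> ext F [:: b; d] \in bases N ->
  ext F [:: a; b] \notin bases N \/ ext F [:: c; d] \notin bases N ->
  coord_at q (ext F [:: a; c]) (ext F [:: b; c])
    = coord_at q (ext F [:: a; d]) (ext F [:: b; d]).
Proof.
move=> fr rF bac bad bbc bbd nb.
have nab : fresh F [:: a; b] /\ fresh F [:: c; d].
  rewrite /fresh /= !inE !negb_or in fr *; split_andb.
  by split; repeat (apply/andP; split).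
rewrite /fresh /= !inE !negb_or in fr.
have ebc : ext F [:: b; c] = ext F [:: a; b; c] :\ a by set_cases.
have eac : ext F [:: a; c] = ext F [:: a; b; c] :\ b by set_cases.
have ebd : ext F [:: b; d] = ext F [:: a; b; d] :\ a by set_cases.
have ead : ext F [:: a; d] = ext F [:: a; b; d] :\ b by set_cases.
have eK : ext F [:: a; b; c; d] :\: [set b; d] = ext F [:: a; c] by set_cases.
have ea : ext F [:: a; b; c; d] :\ a = ext F [:: b; c; d] by set_cases.
have ed : ext F [:: b; c; d] :\ d = ext F [:: b; c] by set_cases.
have sc : ext F [:: a; b; c; d] :\ c = ext F [:: a; b; d] by set_cases.
have sd : ext F [:: a; b; c; d] :\ d = ext F [:: a; b; c] by set_cases.
have sabd : ext F [:: a; b] = ext F [:: a; b; d] :\ d by set_cases.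
have sabc : ext F [:: a; b] = ext F [:: a; b; c] :\ c by set_cases.
have scd : ext F [:: c; d] = ext F [:: b; c; d] :\ b by set_cases.
have ab : a != b by case/and3P: fr => /andP[/andP[]].
have bd : b != d by case/and3P: fr => /and3P[_ /andP[]].
have [||X CX sX] := @base_supp (ext F [:: a; b; c]) b; rewrite -?eac //.
  by rewrite !inE eqxx !orbT.
have [||Y CY sY] := @base_supp (ext F [:: a; b; d]) b; rewrite -?ead //.
  by rewrite !inE eqxx !orbT.
have aX : a \in supp X by apply: (mem_supp CX _ sX); rewrite -ebc base_indep.
have aY : a \in supp Y by apply: (mem_supp CY _ sY); rewrite -ebd base_indep.
rewrite (coordE CX sX ab bac bbc eac ebc) (coordE CY sY ab bad bbd ead ebd).
congr (- _); have iS := base_indep bac; rewrite eac in iS.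
have iS' := base_indep bad; rewrite ead in iS'.
have [eXY|nXY] := pselect (supp X = supp Y).
  by apply: (ratio_uniq b CX CY iS); rewrite -?eXY.
(* A circuit in Fab would lie in both Fabc and Fabd and so equal both supports; only the case of a
   dependent Fcd survives. *)
case: nb => /(dep_of_nbase rF) => [/(_ nab.1)|/(_ nab.2)] /dep_circuit[D cD sD].
  case: nXY; rewrite (circuit_uniq iS (supp_circuit CX) cD sX).
    rewrite (circuit_uniq iS' (supp_circuit CY) cD sY) //.
    by rewrite sabd in sD; apply: subset_trans sD (subD1set _ _).
  by rewrite sabc in sD; apply: subset_trans sD (subD1set _ _).
have [||||V [Z [CV sV CZ]]] := supp_elim CX CY _ _ _ _ nXY aX aY
  (S := ext F [:: a; b; c; d]) (K := [set b; d]).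
- by rewrite eK base_indep.
- by rewrite cards2 bd.
- by rewrite -sd in sX; apply: subset_trans sX (subD1set _ _).
- by rewrite -sc in sY; apply: subset_trans sY (subD1set _ _).
rewrite ea => sZ [Xa nZ]; rewrite -sV in sY aY.
have bZ : b \notin supp Z.
  rewrite (@circuit_uniq _ N (ext F [:: b; c; d]) d (supp Z) D) //.
  - by apply: contraL sD => bD; apply/subsetPn; exists b; rewrite // scd !inE eqxx.
  - by rewrite ed base_indep.
  - exact: supp_circuit.
  - by apply: subset_trans sD _; rewrite scd subD1set.
have := nZ b; rewrite (suppPn bZ) => /null_sum30 e.
rewrite (ratio_uniq b CY CV iS' _ sY); last 2 first.
- by rewrite -sV.
- by rewrite -sV.
by rewrite Xa e tinvN smulNl smulNr.
Qed.

(* (P5) is the elimination of c between the vectors supported in Facd and Fbcd,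
   read at d; the result is supported in Fabd. *)
Lemma circuit_coords_qp5 F a b c d : fresh F [:: a; b; c; d] ->
  ext F [:: a; c] \in bases N -> ext F [:: a; d] \in bases N ->
  ext F [:: b; c] \in bases N -> ext F [:: b; d] \in bases N ->
  ext F [:: a; b] \in bases N -> ext F [:: c; d] \in bases N ->
  null_sum3 (- 1)
    (coord_at q (ext F [:: b; d]) (ext F [:: a; b])
      *_[s] coord_at q (ext F [:: a; c]) (ext F [:: c; d]))
    (coord_at q (ext F [:: a; d]) (ext F [:: a; b])
      *_[s] coord_at q (ext F [:: b; c]) (ext F [:: c; d])).
Proof.
move=> fr bac bad bbc bbd bab bcd; rewrite /fresh /= !inE !negb_or in fr.
have eab : ext F [:: a; b] = ext F [:: a; b; d] :\ d by set_cases.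
have ead : ext F [:: a; d] = ext F [:: a; b; d] :\ b by set_cases.
have ebd : ext F [:: b; d] = ext F [:: a; b; d] :\ a by set_cases.
have eac : ext F [:: a; c] = ext F [:: a; c; d] :\ d by set_cases.
have eca : ext F [:: c; d] = ext F [:: a; c; d] :\ a by set_cases.
have eda : ext F [:: a; d] = ext F [:: a; c; d] :\ c by set_cases.
have ebc : ext F [:: b; c] = ext F [:: b; c; d] :\ d by set_cases.
have ecb : ext F [:: c; d] = ext F [:: b; c; d] :\ b by set_cases.
have edb : ext F [:: b; d] = ext F [:: b; c; d] :\ c by set_cases.
have eK : ext F [:: a; b; c; d] :\: [set b; d] = ext F [:: a; c] by set_cases.
have sc : ext F [:: a; b; c; d] :\ c = ext F [:: a; b; d] by set_cases.
have sa : ext F [:: a; b; c; d] :\ a = ext F [:: b; c; d] by set_cases.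
have sb : ext F [:: a; b; c; d] :\ b = ext F [:: a; c; d] by set_cases.
split_andb; have da : d != a by rewrite eq_sym.
have db : d != b by rewrite eq_sym.
have [||X CX sX] := @base_supp (ext F [:: a; c; d]) d; rewrite -?eac //.
  by rewrite !inE eqxx !orbT.
have [||Y CY sY] := @base_supp (ext F [:: b; c; d]) d; rewrite -?ebc //.
  by rewrite !inE eqxx !orbT.
have aX : a \in supp X by apply: (mem_supp CX _ sX); rewrite -eca base_indep.
have cX : c \in supp X by apply: (mem_supp CX _ sX); rewrite -eda base_indep.
have bY : b \in supp Y by apply: (mem_supp CY _ sY); rewrite -ecb base_indep.
have cY : c \in supp Y by apply: (mem_supp CY _ sY); rewrite -edb base_indep.
have aS : a \notin ext F [:: b; c; d] by rewrite -sa !inE eqxx.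
have bS : b \notin ext F [:: a; c; d] by rewrite -sb !inE eqxx.
have [|||||V [W [CV sV CW]]] := supp_elim CX CY _ _ _ _ _ cX cY
  (S := ext F [:: a; b; c; d]) (K := [set b; d]).
- by rewrite eK base_indep.
- by rewrite cards2; case: (_ != _).
- by rewrite -sb in sX; apply: subset_trans sX (subD1set _ _).
- by rewrite -sa in sY; apply: subset_trans sY (subD1set _ _).
- by move=> e; rewrite e in aX; rewrite (subsetP sY _ aX) in aS.
rewrite sc => sW [_ nW]; rewrite -sV in sY bY.
have Wa := null_sum3_m0 (notin_supp sY aS) (nW a).
have Wb := null_sum3_l0 (notin_supp sX bS) (nW b).
have dW : d \in supp W by apply: (mem_supp CW _ sW); rewrite -eab base_indep.
rewrite (coordE CW sW da bbd bab ebd eab) (coordE CW sW db bad bab ead eab).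
rewrite (@coordE X _ a d _ _ CX sX _ bac bcd eac eca) //.
rewrite (@coordE V _ b d _ _ CV sY _ bbc bcd ebc ecb) //.
rewrite !smulNl !smulNr !toppK Wa Wb !smulA !smulK -?suppE //.
(* Dividing by [W d] turns the last term of the relation at d into -1. *)
apply/null_sum3R/null_sum3R; have := null_sum3_smul s (W d)^-1 (nW d).
by rewrite smulNr smulVl -?suppE.
Qed.

Lemma circuit_coords_quasi_plucker : weak_quasi_plucker s q.
Proof.
split.
- by move=> F a b fr _; apply: circuit_coords_qp1.
- by move=> F a b c fr _; apply: circuit_coords_qp2.
- by move=> F a b c fr _; apply: circuit_coords_qp3.
- exact: circuit_coords_qp4.
- by move=> F a b c d fr _; apply: circuit_coords_qp5.
Qed.

End WeakMatroidCoordinates.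
Lemma tinv1 : (1 : T)^-1 = 1.
Proof. by congr Some; apply: invg1. Qed.

Lemma null_sum3_x0N (x : T) : null_sum3 x 0 (- x).
Proof. by apply: null_sum3R; apply/null_sum30; rewrite toppK. Qed.

(** * From coordinates to a weak matroid *)

Section QuasiPluckerCircuits.
Variable q : adj_bases N -> T.
Hypothesis qQ : weak_quasi_plucker s q.

Lemma card_base_del2 S a b : b \in S -> a != b -> S :\ a \in bases N ->
  #|S :\ a :\ b|.+1 = rank N.
Proof.
move=> bS ab ba; rewrite -(base_card ba) cardsD1S //.
by rewrite !inE eq_sym ab.
Qed.

Lemma card_base_del3 S a b c : b \in S -> c \in S -> a != b -> a != c -> b != c ->
  S :\ a \in bases N -> #|S :\ a :\ b :\ c|.+2 = rank N.
Proof.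
move=> bS cS ab ac bc ba; rewrite -(card_base_del2 bS ab ba).
by rewrite [#|_ :\ c|.+1]cardsD1S // !inE cS eq_sym bc eq_sym ac.
Qed.

Lemma coord_inv S a b : a \in S -> b \in S -> a != b ->
  S :\ b \in bases N -> S :\ a \in bases N ->
  coord_at q (S :\ b) (S :\ a) *_[s] coord_at q (S :\ a) (S :\ b) = 1.
Proof.
move=> aS bS ab bb ba; have [fr eS] := ext2E aS bS ab.
have [eb ea] := ext1E fr (esym eS).
have rF := card_base_del2 bS ab ba.
by have := qp1 qQ fr rF; rewrite -ea -eb; apply.
Qed.

Lemma coord_neq0 S a b : a \in S -> b \in S -> a != b ->
  S :\ b \in bases N -> S :\ a \in bases N -> coord_at q (S :\ b) (S :\ a) != 0.
Proof.
move=> aS bS ab bb ba; have := coord_inv aS bS ab bb ba.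
by apply: contra_eq_neq => ->; case: s; case: (coord_at q).
Qed.

Lemma coord_invE S a b : a \in S -> b \in S -> a != b ->
  S :\ b \in bases N -> S :\ a \in bases N ->
  (coord_at q (S :\ b) (S :\ a))^-1 = coord_at q (S :\ a) (S :\ b).
Proof.
move=> aS bS ab bb ba; have q0 := coord_neq0 aS bS ab bb ba.
by apply: (smulI q0 (s := s)); rewrite smulVr // coord_inv.
Qed.

Lemma coord_triangle S a b c : a \in S -> b \in S -> c \in S ->
  a != b -> a != c -> b != c ->
  S :\ a \in bases N -> S :\ b \in bases N -> S :\ c \in bases N ->
  coord_at q (S :\ b) (S :\ a) *_[s] coord_at q (S :\ c) (S :\ b)
    *_[s] coord_at q (S :\ a) (S :\ c) = - 1.
Proof.
move=> aS bS cS ab ac bc ba bb bc'; pose F := S :\ a :\ b :\ c.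
have fr : fresh F [:: a; b; c].
  by rewrite /fresh /F /= !inE !negb_or ab ac bc !eqxx ?andbF.
have rF : #|F|.+2 = rank N by apply: card_base_del3.
have ea : S :\ a = ext F [:: b; c] by rewrite /F; set_cases.
have eb : S :\ b = ext F [:: a; c] by rewrite /F; set_cases.
have ec : S :\ c = ext F [:: a; b] by rewrite /F; set_cases.
by have := qp2 qQ fr rF; rewrite -ea -eb -ec; apply.
Qed.

(* The bases containing D :\ b and avoiding b, the bases of a contraction, are
   connected by exchanges c -> d; each step is an instance of (P4) since D, and
   hence no basis, is contained in S :\ c. *)
Lemma coord_circuit D S S' a b : D \in circuits N -> a \in D -> b \in D ->
  a != b -> D \subset S -> D \subset S' ->
  S :\ b \in bases N -> S' :\ b \in bases N ->
  coord_at q (S :\ b) (S :\ a) = coord_at q (S' :\ b) (S' :\ a).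
Proof.
move=> cD aD bD ab sD sD' bS bS'; have bS0 := subsetP sD' _ bD.
(* The exchange replaces a point c of S outside S' by a point d of S', which lowers this number; at
   the end S = S', as both exceed a basis by one point. *)
move en: #|S :\: S'| => n; elim/ltn_ind: n S sD bS en => n IHn S sD bS en.
have [aS bS1] := (subsetP sD _ aD, subsetP sD _ bD).
have [sSS|/subsetPn[c cS cS']] := boolP (S \subset S').
  suff -> : S = S' by [].
  apply/eqP; rewrite eqEcard sSS -(cardsD1S bS0) -(cardsD1S bS1).
  by rewrite (base_card bS) (base_card bS') leqnn.
have cD' : c \notin D by apply: contra cS' => /(subsetP sD').
have bc : b != c by apply: contraNneq cD' => <-.
have ac : a != c by apply: contraNneq cD' => <-.
have cSb : c \in S :\ b by rewrite !inE eq_sym bc.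
have i1 : S :\ b :\ c \in indep N.
  exact: indep_sub (subD1set _ _) (base_indep bS).
have [|d] := indep_aug i1 (base_indep bS').
  by rewrite -ltnS cardsD1S // (base_card bS) (base_card bS').
rewrite inE => /andP[dN dS'] id.
have db : d != b by move: dS'; rewrite !inE; case/andP.
have dS0 : d \in S' by move: dS'; rewrite !inE; case/andP.
have dc : d != c by apply: contraTneq dS0 => ->.
have dS : d \notin S by move: dN; rewrite !inE db dc.
pose S2 := d |: (S :\ c); pose F := S :\ a :\ b :\ c.
have ad : a != d by apply: contraNneq dS => <-.
have bd : b != d by rewrite eq_sym.
have cd : c != d by rewrite eq_sym.
have e2 : d |: (S :\ b :\ c) = S2 :\ b by rewrite /S2; set_cases.
have b2 : S2 :\ b \in bases N.
  by rewrite basesE -e2 id cardsU1 dN add1n cardsD1S // (base_card bS) eqxx.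
have sD2 : D \subset S2.
  apply/subsetP=> z zD; rewrite !inE (subsetP sD) // andbT; apply/orP; right.
  by apply: contraNneq cD' => <-.
rewrite -(IHn #|S2 :\: S'| _ S2) //; last first.
  rewrite -en; apply: proper_card; apply/properP; split.
    apply/subsetP=> z; rewrite !inE => /andP[zS'] /orP[/eqP ez|/andP[_ ->]].
      by rewrite ez dS0 in zS'.
    by rewrite zS'.
  by exists c; rewrite !inE ?cS' ?cS // (negPf cd) eqxx.
have e1 : S :\ b = ext F [:: a; c] by rewrite /F; set_cases.
have e3 : S :\ a = ext F [:: b; c] by rewrite /F; set_cases.
have e4 : S2 :\ b = ext F [:: a; d] by rewrite /F /S2; set_cases.
have e5 : S2 :\ a = ext F [:: b; d] by rewrite /F /S2; set_cases.
have e6 : S :\ c = ext F [:: a; b] by rewrite /F; set_cases.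
have fr : fresh F [:: a; b; c; d].
  by rewrite /fresh /F /= !inE !negb_or ab ac ad bc bd cd (negPf dS) !eqxx ?andbF.
have rF : #|F|.+2 = rank N.
  by apply: card_base_del3 => //; apply: base_del bS cD sD aD.
have := qp4 qQ fr rF; rewrite -e1 -e3 -e4 -e5 -e6; apply => //.
- exact: base_del bS cD sD aD.
- exact: base_del b2 cD sD2 aD.
- left; apply: contraL sD => /base_indep/(circuit_nsub cD); apply: contra => sD.
  by rewrite subsetD1 sD.
Qed.

Lemma triangle_solve (t p r : T) : p != 0 -> r != 0 ->
  t *_[s] p *_[s] r = - 1 -> r^-1 *_[s] p^-1 = - t.
Proof.
move=> p0 r0 e; have -> : t = - 1 *_[s] r^-1 *_[s] p^-1 by rewrite -e !smulK.
by rewrite !smulNl toppK smul1l.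
Qed.

(* With c a base point of D, put X c = 1 and X f = - [Fc, Ff]; the choice of F is
   irrelevant by coord_circuit, and (P2) gives the ratios not involving c. *)
Lemma exists_coords_circuit D : D \in circuits N ->
  exists2 X, coords_circuits s q X & supp X = D.
Proof.
move=> cD; have /set0Pn[c cD0] := circuit_neq0 cD.
(* A set S is to be chosen for all f at once; the premise [f \in D] makes the relation total. *)
have hS f : exists S, (f \in D) ==> (D \subset S) && (S :\ f \in bases N).
  have [fD|] := boolP (f \in D); last by exists set0.
  by have [S [sD bS]] := circuit_base cD fD; exists S; rewrite sD bS.
have [Sf {}hS] := choice hS.
pose X : {ffun E -> T} := [ffun f => if f \in D then
  if f == c then 1 else - coord_at q (Sf f :\ f) (Sf f :\ c) else 0].
have XE S g f : D \subset S -> S :\ g \in bases N -> f \in D -> f != c ->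
    X f = - coord_at q (S :\ f) (S :\ c).
  move=> sD bS fD fc; have /andP[sDf bSf] := implyP (hS f) fD.
  rewrite ffunE fD (negPf fc) (@coord_circuit D (Sf f) S c f) 1?eq_sym //.
  exact: base_del bS cD sD fD.
have Xc : X c = 1 by rewrite ffunE cD0 eqxx.
have eX : supp X = D.
  apply/setP=> f; rewrite suppE; have [->|fc] := eqVneq f c; first by rewrite Xc cD0.
  have [fD|fD] := boolP (f \in D); last by rewrite ffunE (negPf fD) eqxx.
  have [S [sD bS]] := circuit_base cD fD.
  rewrite (XE S f) // topp_eq0 coord_neq0 ?(subsetP sD) 1?eq_sym //.
  exact: base_del bS cD sD cD0.
exists X => //; apply/coords_circuitsP; rewrite eX; split=> // S a b aD bD ab sD bS.
have bas e : e \in D -> S :\ e \in bases N by apply: base_del bS cD sD.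
have inS := subsetP sD.
have [ac|ac] := eqVneq a c.
  by rewrite ac Xc tinv1 smul1l (XE S b) // -ac eq_sym.
have [bc|bc] := eqVneq b c.
  rewrite bc Xc smul1r (XE S b) // tinvN coord_invE ?inS ?bas //.
  by rewrite eq_sym.
have ca : c != a by rewrite eq_sym.
have cb : c != b by rewrite eq_sym.
have [aS [bS' cS]] := (inS _ aD, (inS _ bD, inS _ cD0)).
have [ba [bb bc']] := (bas _ aD, (bas _ bD, bas _ cD0)).
rewrite (XE S b a) // (XE S b b) // tinvN smulNl smulNr toppK.
rewrite -(coord_invE bS' cS bc) //; apply: triangle_solve.
- by rewrite coord_neq0.
- by rewrite coord_neq0.
- exact: coord_triangle.
Qed.

Lemma coords_extE X S G a b g B B' : coords_circuits s q X ->
  a \in supp X -> b \in supp X -> supp X \subset S -> fresh G [:: a; b; g] ->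
  B \in bases N -> S = ext G [:: a; b; g] -> B = ext G [:: a; g] ->
  B' = ext G [:: b; g] -> coord_at q B B' = - ((X a)^-1 *_[s] X b).
Proof.
move=> qX aX bX sX fr bB eS eB eB'; rewrite /fresh /= !inE !negb_or in fr.
apply: (coordsE qX aX bX _ sX bB).
- by case/andP: fr => /andP[/andP[]].
- by rewrite eS eB; set_cases.
- by rewrite eS eB'; set_cases.
Qed.

(* Choose c, d in the two differences of the supports and complete the union
   minus c, d to a basis Fe. Z lives on the circuit in Fcd, scaled by
   Z c = X c; then (P3) gives Z d = Y d. At f in F, with F = Gf, f lies on the
   supports of X, Y, Z iff Gce, Gde, Gcd are bases, and by modularity f cannot
   lie on exactly one support: (P5) applies if it lies on all three and (P4) if it
   lies on two. *)
Lemma coords_circuits_elim X Y e :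
  coords_circuits s q X -> coords_circuits s q Y ->
  modular_pair [set A | A \in circuits N]%classic (supp X) (supp Y) ->
  X e = - Y e -> X e != 0 ->
  exists Z, [/\ coords_circuits s q Z, Z e = 0 &
    forall f, null_sum3 (X f) (Y f) (- Z f)].
Proof.
move=> qX qY mXY XYe Xe0.
have [[c cXY] [d dYX]] := modular_pair_neq mXY.
have iU := modular_pair_indep mXY cXY dYX.
have [cX cNY] : c \in supp X /\ c \notin supp Y by case/setDP: cXY.
have [dY dNX] : d \in supp Y /\ d \notin supp X by case/setDP: dYX.
have eX : e \in supp X by rewrite suppE.
have eY : e \in supp Y by rewrite suppE -topp_eq0 -XYe.
have ec : e != c by apply: contraNneq cNY => <-.
have ed : e != d by apply: contraNneq dNX => <-.
have cd : c != d by apply: contraNneq cNY => ->.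
have [CX CY] : supp X \in circuits N /\ supp Y \in circuits N.
  by case: qX; case: qY.
set U := supp X :|: supp Y in iU.
have [B0 bB0] := exists_base N.
have [B [bB sUB _]] := indep_base iU bB0.
have inB f : f \in U -> f != c -> f != d -> f \in B.
  by move=> fU fc fd; apply: (subsetP sUB); rewrite in_setD1 fd in_setD1 fc.
have sXB : supp X \subset c |: B.
  apply/subsetP=> f fX; rewrite in_setU1; have [//|fc] := eqVneq f c.
  apply: inB => //; first by rewrite in_setU fX.
  by apply: contraNneq dNX => <-.
have sYB : supp Y \subset d |: B.
  apply/subsetP=> f fY; rewrite in_setU1; have [//|fd] := eqVneq f d.
  apply: inB => //; first by rewrite in_setU fY orbT.
  by apply: contraNneq cNY => <-.
have cB : c \notin B.
  apply: contra (circuit_nsub CX (base_indep bB)) => cB.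
  by apply: subset_trans sXB _; rewrite subUset sub1set cB subxx.
have dB : d \notin B.
  apply: contra (circuit_nsub CY (base_indep bB)) => dB.
  by apply: subset_trans sYB _; rewrite subUset sub1set dB subxx.
have eU : e \in U by rewrite in_setU eX.
have eB : e \in B by apply: inB.
have [F [eBF eF]] : exists F, B = e |: F /\ e \notin F.
  by exists (B :\ e); rewrite setD1K // !inE eqxx.
have cF : c \notin F by apply: contra cB; rewrite eBF in_setU1 => ->; rewrite orbT.
have dF : d \notin F by apply: contra dB; rewrite eBF in_setU1 => ->; rewrite orbT.
have inF f : f \in U -> f != c -> f != d -> f != e -> f \in F.
  by move=> fU fc fd fe; have := inB f fU fc fd; rewrite eBF in_setU1 (negPf fe).
have bc : c |: F \in bases N.
  rewrite (_ : c |: F = (c |: B) :\ e); last by rewrite eBF; set_cases.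
  by apply: (base_del (x := c) _ CX sXB eX); rewrite setU1K.
have bd : d |: F \in bases N.
  rewrite (_ : d |: F = (d |: B) :\ e); last by rewrite eBF; set_cases.
  by apply: (base_del (x := d) _ CY sYB eY); rewrite setU1K.
(* Were [U :\ e] independent, U would contain a single circuit, and the two supports would agree. *)
have [D CD sDU] : exists2 D, D \in circuits N & D \subset U :\ e.
  apply: dep_circuit; apply: contraTN cX => iUe; apply: contra cNY.
  by rewrite (circuit_uniq iUe CX CY) ?subsetUl ?subsetUr.
have sDF : D \subset c |: (d |: F).
  apply: subset_trans sDU _; apply/subsetP=> f; rewrite in_setD1 => /andP[fe fU].
  rewrite !in_setU1; have [//|fc] := eqVneq f c.
  by have [//|fd] := eqVneq f d; apply: inF.
have ecd : (c |: (d |: F)) :\ c = d |: F by set_cases.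
have edc : (c |: (d |: F)) :\ d = c |: F by set_cases.
have cD : c \in D by apply: mem_circuit CD sDF; rewrite ecd base_indep.
have dD : d \in D by apply: mem_circuit CD sDF; rewrite edc base_indep.
have [Z0 qZ0 eZ0] := exists_coords_circuit CD.
have cZ0 : Z0 c != 0 by rewrite -suppE eZ0.
have cX0 : X c != 0 by rewrite -suppE.
have z0 : X c *_[s] (Z0 c)^-1 != 0 by rewrite smul_neq0 tinv_neq0 cX0.
pose Z := scale s (X c *_[s] (Z0 c)^-1) Z0.
have qZ : coords_circuits s q Z by apply: coords_scaled.
have eZ : supp Z = D by rewrite supp_scale.
have Zc : Z c = X c by rewrite ffunE smulVK.
have eUD : e \notin D.
  by apply: contraL sDU => eD; apply/subsetPn; exists e; rewrite // !inE eqxx.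
exists Z; split=> //; first by apply: suppPn; rewrite eZ.
have Zd : Z d = Y d.
  have fr : fresh F [:: e; c; d] by rewrite /fresh /= !inE !negb_or ec ed cd eF cF dF.
  have rF : #|F|.+1 = rank N by rewrite -(base_card bB) eBF cardsU1 eF.
  have e1 f : ext F [:: f] = f |: F by set_cases.
  have := qp3 qQ fr rF; rewrite !e1 -eBF => /(_ bB bc bd).
  rewrite (@coordsE q X (c |: B) e c) // ?suppE //; last 2 first.
  - by rewrite setU1K.
  - by rewrite eBF; set_cases.
  rewrite (@coordsE q Z (c |: (d |: F)) c d) ?eZ //.
  rewrite (@coordsE q Y (d |: B) d e) 1?eq_sym //; last 2 first.
  - by rewrite eBF; set_cases.
  - by rewrite setU1K.
  have Ye : Y e != 0 by rewrite -suppE.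
  have Yd : Y d != 0 by rewrite -suppE.
  rewrite Zc XYe tinvN !smulNl !smulNr !smulNl !toppK !smulA smulK // => e0.
  have : Z d *_[s] (Y d)^-1 = 1.
    apply: (@smulI _ s (Y e)^-1); first by rewrite tinv_neq0.
    by rewrite smulA -[LHS](smulK s _ Ye) e0 smul1l smul1r.
  by move=> /(congr1 (fun x => x *_[s] Y d)); rewrite smulVK // smul1l.
move=> f; have [fU|fU] := boolP (f \in U); last first.
  have fX : f \notin supp X by apply: contra fU; rewrite in_setU => ->.
  have fY : f \notin supp Y by apply: contra fU; rewrite in_setU => ->; rewrite orbT.
  have fZ : f \notin supp Z.
    by rewrite eZ; apply: contra fU => /(subsetP sDU); rewrite in_setD1 => /andP[].
  by rewrite (suppPn fX) (suppPn fY) (suppPn fZ); apply: null_sum3_x0N.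
have [->|fe] := eqVneq f e.
  rewrite [Z e]suppPn ?eZ // XYe; apply: null_sum3C; exact/null_sum30.
have [->|fc] := eqVneq f c.
  by rewrite Zc (suppPn cNY); apply: null_sum3_x0N.
have [->|fd] := eqVneq f d.
  by rewrite Zd (suppPn dNX); apply: null_sum3C; apply: null_sum3_x0N.
have := inF f fU fc fd fe => fF.
have [G [eFG fG]] : exists G, F = f |: G /\ f \notin G.
  by exists (F :\ f); rewrite setD1K // !inE eqxx.
have eG : e \notin G by apply: contra eF; rewrite eFG in_setU1 => ->; rewrite orbT.
have cG : c \notin G by apply: contra cF; rewrite eFG in_setU1 => ->; rewrite orbT.
have dG : d \notin G by apply: contra dF; rewrite eFG in_setU1 => ->; rewrite orbT.
rewrite {}eFG in eBF bc bd sDF ecd edc; rewrite {}eBF in bB sXB sYB cB dB.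
have rG : #|G|.+2 = rank N.
  by rewrite -(base_card bB) !cardsU1 !inE [e == f]eq_sym (negPf fe) (negPf eG) fG.
have extC x y : ext G [:: x; y] = ext G [:: y; x].
  by apply/setP=> z; rewrite !inE [(z == x) || _]orbC.
have bef : ext G [:: e; f] \in bases N.
  by rewrite (_ : ext _ _ = e |: (f |: G)) //; clear -fe; set_cases.
have bcf : ext G [:: c; f] \in bases N.
  by rewrite (_ : ext _ _ = c |: (f |: G)) //; clear -fe; set_cases.
have bdf : ext G [:: d; f] \in bases N.
  by rewrite (_ : ext _ _ = d |: (f |: G)) //; clear -fe; set_cases.
have {}sXB : supp X \subset ext G [:: c; e; f].
  by rewrite (_ : ext _ _ = c |: (e |: (f |: G))) //; clear -fe; set_cases.
have {}sYB : supp Y \subset ext G [:: d; e; f].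
  by rewrite (_ : ext _ _ = d |: (e |: (f |: G))) //; clear -fe; set_cases.
have {}sDF : D \subset ext G [:: c; d; f].
  by rewrite (_ : ext _ _ = c |: (d |: (f |: G))) //; clear -fe; set_cases.
have ce : c != e by rewrite eq_sym.
have de : d != e by rewrite eq_sym.
have [dc [cf df]] : d != c /\ c != f /\ d != f.
  by rewrite ![_ == f]eq_sym [d == c]eq_sym.
have mem_base x y K : K \in circuits N -> K \subset ext G [:: x; y; f] ->
    x != y -> x != f -> y != f -> x \notin G -> y \notin G ->
    ext G [:: y; f] \in bases N -> (f \in K) = (ext G [:: x; y] \in bases N).
  move=> CK sK xy xf yf xG yG byf.
  have e1 : ext G [:: y; f] = ext G [:: x; y; f] :\ x.
    by clear -xy xf yf xG yG fG; set_cases.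
  have e2 : ext G [:: x; y] = ext G [:: x; y; f] :\ f.
    by clear -xy xf yf xG yG fG; set_cases.
  rewrite e2; rewrite e1 in byf; apply/idP/idP => [fK|/base_indep iK].
    exact: base_del byf CK sK fK.
  exact: mem_circuit iK CK sK.
have ef : e != f by rewrite eq_sym.
have bX := mem_base _ _ _ CX sXB ce cf ef cG eG bef.
have bY := mem_base _ _ _ CY sYB de df ef dG eG bef.
have bZ := mem_base _ _ _ CD sDF cd cf df cG dG bdf.
have fr3 x y z : x != y -> x != z -> y != z -> x \notin G -> y \notin G -> z \notin G ->
    fresh G [:: x; y; z].
  by move=> xy xz yz xG yG zG; rewrite /fresh /= !inE !negb_or xy xz yz xG yG zG.
have frX : fresh G [:: c; f; e] by apply: fr3; rewrite // eq_sym.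
have frY : fresh G [:: d; f; e] by apply: fr3; rewrite // eq_sym.
have frZc : fresh G [:: f; d; c] by apply: fr3; rewrite // eq_sym.
have frZd : fresh G [:: f; c; d] by apply: fr3; rewrite // eq_sym.
have frXc : fresh G [:: e; f; c] by apply: fr3; rewrite // eq_sym.
have frYd : fresh G [:: e; f; d] by apply: fr3; rewrite // eq_sym.
have frZcf : fresh G [:: c; f; d] by apply: fr3; rewrite // eq_sym.
have frZdf : fresh G [:: d; f; c] by apply: fr3; rewrite // eq_sym.
have sZB : supp Z \subset ext G [:: c; d; f] by rewrite eZ.
have eX0 : X e != 0 by rewrite -suppE.
have eY0 : Y e != 0 by rewrite -suppE.
have dY0 : Y d != 0 by rewrite -suppE.
have [fX|fX] := boolP (f \in supp X); have [fY|fY] := boolP (f \in supp Y);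
  have [fD|fD] := boolP (f \in D).
- have frG : fresh G [:: c; d; e; f].
    by rewrite /fresh /= !inE !negb_or cd ce cf de df ef cG dG eG fG.
  have := qp5 qQ frG rG; rewrite -bX -bY -bZ => /(_ fX bcf fY bdf fD bef).
  have -> : coord_at q (ext G [:: d; f]) (ext G [:: c; d]) = - ((Z f)^-1 *_[s] Z c).
    by apply: (coords_extE qZ _ _ sZB frZd); rewrite ?eZ //; ext_perm.
  have -> : coord_at q (ext G [:: c; f]) (ext G [:: c; d]) = - ((Z f)^-1 *_[s] Z d).
    by apply: (coords_extE qZ _ _ sZB frZc); rewrite ?eZ //; ext_perm.
  have -> : coord_at q (ext G [:: c; e]) (ext G [:: e; f]) = - ((X c)^-1 *_[s] X f).
    by apply: (coords_extE qX _ _ sXB frX); rewrite -?bX //; ext_perm.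
  have -> : coord_at q (ext G [:: d; e]) (ext G [:: e; f]) = - ((Y d)^-1 *_[s] Y f).
    by apply: (coords_extE qY _ _ sYB frY); rewrite -?bY //; ext_perm.
  have fZ0 : Z f != 0 by rewrite -suppE eZ.
  (* Multiplying (P5) by [Z f] cancels the inverses, because Z agrees with X at c and with Y at
     d. *)
  rewrite !smulNl !smulNr !toppK Zc Zd !smulA !smulK // => /(null_sum3_smul s (Z f)).
  rewrite smulNr smul1r !smulA !smulVr // !smul1l.
  by move/null_sum3R.
(* As f is not in D, Gcd is not a basis, so (P4) equates the exchange of e for f beside c and beside
   d; opposite values of X and Y at e give opposite values at f. *)
- have frG : fresh G [:: e; f; c; d].
    rewrite /fresh /= !inE !negb_or cd eG fG cG dG ef.
    by rewrite [e == c]eq_sym [e == d]eq_sym ![f == _]eq_sym ce de cf df.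
  have := qp4 qQ frG rG; rewrite ![ext G [:: e; _]]extC ![ext G [:: f; _]]extC.
  rewrite -bX -bY -bZ => /(_ fX fY bcf bdf (or_intror fD)).
  have -> : coord_at q (ext G [:: c; e]) (ext G [:: c; f]) = - ((X e)^-1 *_[s] X f).
    by apply: (coords_extE qX _ _ sXB frXc); rewrite -?bX //; ext_perm.
  have -> : coord_at q (ext G [:: d; e]) (ext G [:: d; f]) = - ((Y e)^-1 *_[s] Y f).
    by apply: (coords_extE qY _ _ sYB frYd); rewrite -?bY //; ext_perm.
  rewrite (suppPn (X := Z)) ?eZ // XYe tinvN smulNl toppK -smulNr.
  by move/smulI; rewrite tinv_neq0 => /(_ eY0) ->; apply/null_sum30; rewrite toppK.
- have frG : fresh G [:: c; f; e; d].
    rewrite /fresh /= !inE !negb_or cf ce cd cG fG eG dG fd fe.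
    by rewrite [e == d]eq_sym de.
  have := qp4 qQ frG rG; rewrite ![ext G [:: f; _]]extC [ext G [:: e; d]]extC.
  rewrite -bX -bY -bZ => /(_ fX fD bef bdf (or_intror fY)).
  have -> : coord_at q (ext G [:: c; e]) (ext G [:: e; f]) = - ((X c)^-1 *_[s] X f).
    by apply: (coords_extE qX _ _ sXB frX); rewrite -?bX //; ext_perm.
  have -> : coord_at q (ext G [:: c; d]) (ext G [:: d; f]) = - ((Z c)^-1 *_[s] Z f).
    by apply: (coords_extE qZ _ _ sZB frZcf); rewrite -?bZ ?eZ //; ext_perm.
  rewrite Zc (suppPn fY) => /topp_inj/smulI; rewrite tinv_neq0 => /(_ cX0) ->.
  exact: null_sum3_x0N.
(* With f only on X, modularity makes [U :\ f :\ d] independent. Then [U :\ f] contains just one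
   circuit, so D would be the support of Y, which contains e. *)
- have /negP[] := eUD; suff <- : supp Y = D by [].
  have fXY : f \in supp X :\: supp Y by rewrite in_setD fX fY.
  apply: (circuit_uniq (modular_pair_indep mXY fXY dYX) CY CD).
    by rewrite subsetD1 fY subsetUr.
  by rewrite subsetD1 fD andbT; apply: subset_trans sDU (subD1set _ _).
- have frG : fresh G [:: d; f; e; c].
    rewrite /fresh /= !inE !negb_or df de dc cG fG eG dG fc fe.
    by rewrite ec.
  have := qp4 qQ frG rG; rewrite ![ext G [:: f; _]]extC [ext G [:: e; c]]extC.
  rewrite [ext G [:: d; c]]extC -bX -bY -bZ => /(_ fY fD bef bcf (or_intror fX)).
  have -> : coord_at q (ext G [:: d; e]) (ext G [:: e; f]) = - ((Y d)^-1 *_[s] Y f).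
    by apply: (coords_extE qY _ _ sYB frY); rewrite -?bY //; ext_perm.
  have -> : coord_at q (ext G [:: c; d]) (ext G [:: c; f]) = - ((Z d)^-1 *_[s] Z f).
    by apply: (coords_extE qZ _ _ sZB frZdf); rewrite -?bZ ?eZ //; ext_perm.
  rewrite Zd (suppPn fX) => /topp_inj/smulI; rewrite tinv_neq0 => /(_ dY0) ->.
  by apply: null_sum3C; apply: null_sum3_x0N.
- have /negP[] := eUD; suff <- : supp X = D by [].
  have fYX : f \in supp Y :\: supp X by rewrite in_setD fX fY.
  have := modular_pair_indep mXY cXY fYX.
  rewrite setDDl [[set c] :|: _]setUC -setDDl => iUf; apply: (circuit_uniq iUf CX CD).
    by rewrite subsetD1 fX subsetUl.
  by rewrite subsetD1 fD andbT; apply: subset_trans sDU (subD1set _ _).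
- by move: fU; rewrite in_setU (negPf fX) (negPf fY).
- by move: fU; rewrite in_setU (negPf fX) (negPf fY).
Qed.

Lemma coords_underlying : underlying_matroid_is (coords_circuits s q) N.
Proof.
apply/seteqP; split=> [D [X [cX _] <-]|D /exists_coords_circuit[X qX <-]] //.
by exists X.
Qed.

Lemma coords_circuits_weak_matroid : weak_matroid s (coords_circuits s q).
Proof.
split.
- case=> /circuit_neq0/set0Pn[e]; rewrite suppE ffunE => /eqP; by case.
- by move=> X x qX /eqP x0; apply: coords_scaled.
- move=> X Y qX qY sXY; have [cX cY] : supp X \in circuits N /\ supp Y \in circuits N.
    by case: qX; case: qY.
  have [x /eqP x0 ->] := coords_scale qX qY (circuit_sub cX cY sXY).
  by exists x.
- move=> X Y e qX qY; rewrite coords_underlying => mXY XYe /eqP Xe0.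
  exact: coords_circuits_elim.
Qed.

(** Both sides are the same ratio of one vector on the circuit in the union of the two bases: for q
    by the choice of the vectors, for [circuit_coords] because these vectors are already known to
    form a weak matroid over N. *)
Lemma coords_circuits_coords : q = circuit_coords s (coords_circuits s q).
Proof.
apply/funext=> -[[B B'] adj]; rewrite -!coord_at_val.
have /and3P[/= bB bB' /cards1P[a eBa]] := adj.
have /cards1P[b eBb] : #|B' :\: B| == 1%N.
  rewrite -(eqn_add2l #|B' :&: B|) cardsID (base_card bB') -(base_card bB).
  by rewrite setIC -(cardsID B' B) eBa cards1.
have /setDP[aB aB'] : a \in B :\: B' by rewrite eBa set11.
have /setDP[bB'0 bB0] : b \in B' :\: B by rewrite eBb set11.
have ab : a != b by apply: contraNneq bB0 => <-.
pose S := b |: B; have eB : B = S :\ b by rewrite setU1K.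
have eB' : B' = S :\ a.
  apply/setP=> z; move/setP: eBa => /(_ z); move/setP: eBb => /(_ z).
  rewrite !inE; have [->|zb] := eqVneq z b; first by rewrite bB'0 eq_sym ab.
  by case: (z \in B); case: (z \in B') => //=; case: (z == a).
rewrite eB eB' in bB bB' *.
have [||D cD sD] := @base_circuit _ N S b; rewrite ?setU11 //.
have aX := mem_circuit (base_indep bB') cD sD.
have bX := mem_circuit (base_indep bB) cD sD.
have [X qX eX] := exists_coords_circuit cD; rewrite -eX in sD aX bX.
rewrite (coordsE qX aX bX ab sD bB erefl erefl).
by rewrite (circuit_coordsE coords_circuits_weak_matroid coords_underlying
  qX aX bX ab sD bB).
Qed.

End QuasiPluckerCircuits.
End Coordinates.

Theorem theorem3p13 (s : side) (E : finType) (N : matroid E) (T : skewTract)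
    (q : adj_bases N -> T) (C : set {ffun E -> T}) (E_nonempty : 0 < #|E|) :
  [/\ weak_matroid s C, underlying_matroid_is C N & q = circuit_coords s C]
  <->
  weak_quasi_plucker s q /\ C = coords_circuits s q.
Proof.
split=> [[wC uC qC]|[qQ ->]].
  by split; [apply: circuit_coords_quasi_plucker wC uC _ qC|apply: coords_circuitsE].
split.
- exact: coords_circuits_weak_matroid.
- exact: coords_underlying.
- exact: coords_circuits_coords.
Qed.
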